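(* Let $v$ be a point which is not a pole of $\wp(\cdot;g_2,g_3)$ and let $\Phi(u;v)=\frac{\sigma(v-u)}{\sigma(u)\sigma(v)}\exp(\zeta(v)u)$ be the Baker–Akhiezer function. Then in the vicinity of $u=0$ the function $f_0(u)=1/\Phi(u;v)$ is a Hurwitz series over $\mathbb{Z}[a_2,a_3,a_4]$, where $a_2=\wp(v)$, $a_3=\wp'(v)$, $a_4=\frac12g_2$; that is, $f_0(u)=\sum_{k\ge0}P_k(a_2,a_3,a_4)u^k/k!$ for polynomials $P_k$ with integer coefficients.
   Context: $\wp(u)=\wp(u;g_2,g_3)$ is the Weierstrass function ($\wp'^2=4\wp^3-g_2\wp-g_3$), $\sigma$ the Weierstrass sigma function (entire, odd, $\sigma(u)=u+O(u^5)$), $\zeta=\sigma'/\sigma$, $\wp=-\zeta'$. A Hurwitz series over a ring $A$ is a series $\sum_k\varphi_ku^k/k!$ with all $\varphi_k\in A$. *)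

(* Defs.v *)
From Stdlib Require Import Reals ZArith List.
From Coquelicot Require Import Coquelicot.
Open Scope R_scope.

Definition Cexp (z : C) : C :=
  (exp (Re z) * cos (Im z), exp (Re z) * sin (Im z)).

(* A polynomial in three variables with integer coefficients, given as a
   finite list of monomials  c * X^i * Y^j * Z^k  (c : Z). *)
Definition zpoly3 := list (Z * (nat * nat * nat)).

Definition zpoly3_eval (p : zpoly3) (x y z : C) : C :=
  fold_right
    (fun (m : Z * (nat * nat * nat)) (acc : C) =>
       let '(c, (i, j, k)) := m in
       Cplus (Cmult (RtoC (IZR c))
                    (Cmult (Cpow x i) (Cmult (Cpow y j) (Cpow z k)))) acc)
    (RtoC 0) p.

Definition BA (sigma zeta : C -> C) (u v : C) : C :=
  Cmult (Cdiv (sigma (Cminus v u)) (Cmult (sigma u) (sigma v)))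
        (Cexp (Cmult (zeta v) u)).

(* Main.v *)
(** The function [f = 1 / Phi] satisfies [f' = L f] with
    [L = zeta(u) + zeta(v - u) - zeta(v)], and the addition theorem
    [L^2 = wp(u) + wp(v - u) + wp(v)] together with [L' = wp(v - u) - wp(u)] gives the
    linear equation [f'' = (2 wp(v - u) + wp(v)) f], with [f(0) = 0] and [f'(0) = 1].
    Since [wp'' = 6 wp^2 - g2 / 2], every derivative of [f] is [a f + b f'] where [a], [b] are
    integer polynomials in [wp(v - u)], [wp'(v - u)], [g2 / 2], [wp(v)]; at [u = 0] it is [b].

    Holomorphy enters in three places: a complex differentiable function is the sum of its
    Taylor series (Goursat, then Cauchy), so [wp'] is differentiable and the series of [f]
    converges to [f]; the bound [sigma(u) = u + O(u^5)] can be differentiated, which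
    yields the behaviour of [zeta] and [wp] at [0]; and [wp'' = 6 wp^2 - g2 / 2], clear near [0]
    where [wp'] does not vanish, propagates because [sigma^4 (wp'' - 6 wp^2 + g2 / 2)] is an
    entire function. *)

Require Import Defs.
From Stdlib Require Import Reals ZArith List Lra Lia.
From Coquelicot Require Import Coquelicot.
Open Scope R_scope.

(** The hypotheses describe sigma, zeta and wp by differential relations and by one expansion at 0.
    Neither periods nor a lattice occur, so the classical proof of the addition theorem, which
    compares poles of elliptic functions by Liouville's theorem, is replaced by one that
    differentiates and compares expansions on a small punctured disc. Discs and rays from 0 suffice
    for this.

    Integrality rests on the choice of coordinates. Near u = 0 the functions wp(u) and zeta(u) have
    poles, whereas wp(v - u) and wp'(v - u) are regular and, together with g2 / 2 and wp(v), are
    closed under differentiation with integer coefficients. The denominator 2 of the addition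
    theorem never enters, because f'' involves only L' and L^2. The polynomials come from a purely
    formal recursion on lists of integer monomials, so they can be chosen before sigma, g2, g3 and
    v. *)

(** * Derivatives of functions of a complex and of a real variable *)

(* Coquelicot proves the product and chain rules for values in the ring itself, not in
   [C_NormedModule], whose uniform structure is that of a product. *)
Definition cderiv (f : C -> C) (z l : C) : Prop :=
  is_derive (K := C_AbsRing) (V := AbsRing_NormedModule C_AbsRing) f z l.

Definition rderiv (f : R -> C) (t : R) (l : C) : Prop :=
  is_derive (K := R_AbsRing) (V := C_R_NormedModule) f t l.

Definition ccont (f : R -> C) (t : R) : Prop :=
  continuous (T := R_UniformSpace) (U := AbsRing_UniformSpace C_AbsRing) f t.

(** The error term involves only the norm of the target, which is [Cmod] for both structures; just
    the linearity of the candidate derivative has to be proved anew. *)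
Lemma cderiv_normed (f : C -> C) (z l : C) :
  is_derive (K := C_AbsRing) (V := C_NormedModule) f z l <-> cderiv f z l.
Proof.
  split; intros [_ H]; (split; [apply is_linear_scal_l|exact H]).
Qed.

Lemma cderiv_spec (f : C -> C) (z l : C) :
  cderiv f z l <->
  forall eps, 0 < eps -> exists d, 0 < d /\
    forall w, Cmod (w - z) < d -> Cmod (f w - f z - l * (w - z)) <= eps * Cmod (w - z).
Proof.
  split.
  - intros [_ H] eps He.
    destruct (H z (fun P HP => HP) (mkposreal eps He)) as [d Hd].
    exists d; split; [apply cond_pos|].
    intros w Hw. specialize (Hd w Hw).
    replace (f w - f z - l * (w - z))%C with (f w - f z - (w - z) * l)%C by ring.
    exact Hd.
  - intros H; split; [apply is_linear_scal_l|].
    intros x Hx eps.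
    rewrite <- (is_filter_lim_locally_unique _ _ Hx).
    destruct (H eps (cond_pos eps)) as [d [Hd H1]].
    exists (mkposreal d Hd); intros w Hw. specialize (H1 w Hw).
    replace (f w - f z - l * (w - z))%C with (f w - f z - (w - z) * l)%C in H1 by ring.
    exact H1.
Qed.

Lemma rderiv_spec (f : R -> C) (t : R) (l : C) :
  rderiv f t l <->
  forall eps, 0 < eps -> exists d, 0 < d /\
    forall s, Rabs (s - t) < d -> Cmod (f s - f t - l * (s - t)%R) <= eps * Rabs (s - t).
Proof.
  split.
  - intros [_ H] eps He.
    destruct (H t (fun P HP => HP) (mkposreal eps He)) as [d Hd].
    exists d; split; [apply cond_pos|].
    intros s Hs. specialize (Hd s Hs).
    replace (f s - f t - l * (s - t)%R)%C with (minus (minus (f s) (f t)) (scal (minus s t) l)).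
    rewrite Cmod_norm. exact Hd.
    unfold minus at 3; rewrite scal_R_Cmult; unfold minus, plus, opp; simpl.
    change (f s - f t - (s - t)%R * l = f s - f t - l * (s - t)%R)%C. ring.
  - intros H; split; [apply is_linear_scal_l|].
    intros x Hx eps.
    rewrite <- (is_filter_lim_locally_unique _ _ Hx).
    destruct (H eps (cond_pos eps)) as [d [Hd H1]].
    exists (mkposreal d Hd); intros s Hs. specialize (H1 s Hs).
    replace (f s - f t - l * (s - t)%R)%C with (minus (minus (f s) (f t)) (scal (minus s t) l)) in H1.
    rewrite Cmod_norm in H1. exact H1.
    unfold minus at 3; rewrite scal_R_Cmult; unfold minus, plus, opp; simpl.
    change (f s - f t - (s - t)%R * l = f s - f t - l * (s - t)%R)%C. ring.
Qed.

Lemma ccont_spec (f : R -> C) (t : R) :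
  ccont f t <->
  forall eps, 0 < eps -> exists d, 0 < d /\
    forall s, Rabs (s - t) < d -> Cmod (f s - f t) < eps.
Proof.
  split.
  - intros H eps He.
    destruct (H (fun y => Cmod (y - f t) < eps)) as [d Hd].
    exists (mkposreal eps He); intros y Hy; exact Hy.
    exists d; split; [apply cond_pos|exact Hd].
  - intros H P [e He].
    destruct (H e (cond_pos e)) as [d [Hd H1]].
    exists (mkposreal d Hd); intros s Hs. apply He. exact (H1 s Hs).
Qed.

Lemma ccont_prod (f : R -> C) (t : R) :
  ccont f t -> continuous (T := R_UniformSpace) (U := C_UniformSpace) f t.
Proof. intros H P HP. apply H. apply locally_C. exact HP. Qed.

Lemma cderiv_continuous_spec (f : C -> C) (z l : C) :
  cderiv f z l -> forall eps, 0 < eps -> exists d, 0 < d /\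
    forall w, Cmod (w - z) < d -> Cmod (f w - f z) < eps.
Proof.
  intros H eps He.
  destruct (proj1 (cderiv_spec f z l) H 1 Rlt_0_1) as [d [Hd H1]].
  pose proof (Cmod_ge_0 l) as Hl.
  assert (Hq : 0 < eps / (Cmod l + 2)) by (apply Rdiv_lt_0_compat; lra).
  exists (Rmin d (eps / (Cmod l + 2))); split.
  - apply Rmin_glb_lt; lra.
  - intros w Hw.
    assert (A := Rlt_le_trans _ _ _ Hw (Rmin_l _ _)).
    assert (B := Rlt_le_trans _ _ _ Hw (Rmin_r _ _)).
    specialize (H1 w A).
    replace (f w - f z)%C with ((f w - f z - l * (w - z)) + l * (w - z))%C by ring.
    eapply Rle_lt_trans; [apply Cmod_triangle|]. rewrite Cmod_mult.
    apply Rle_lt_trans with ((Cmod l + 1) * Cmod (w - z)); [lra|].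
    apply Rle_lt_trans with ((Cmod l + 1) * (eps / (Cmod l + 2))).
    apply Rmult_le_compat_l; lra.
    apply Rmult_lt_reg_r with (Cmod l + 2); [lra|].
    field_simplify; [|lra]. nra.
Qed.

Lemma ccont_comp (g : C -> C) (c : R -> C) (t : R) (l : C) :
  cderiv g (c t) l -> ccont c t -> ccont (fun s => g (c s)) t.
Proof.
  intros Hg Hc. apply ccont_spec. intros eps He.
  destruct (cderiv_continuous_spec _ _ _ Hg eps He) as [d [Hd H1]].
  destruct (proj1 (ccont_spec c t) Hc d Hd) as [d' [Hd' H2]].
  exists d'; split; [exact Hd'|]. intros s Hs. apply H1, H2, Hs.
Qed.

Lemma ccont_mult (f g : R -> C) (t : R) :
  ccont f t -> ccont g t -> ccont (fun s => f s * g s)%C t.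
Proof. intros Hf Hg. exact (continuous_mult (K := C_AbsRing) f g t Hf Hg). Qed.

Lemma rderiv_ccont (f : R -> C) (t : R) (l : C) : rderiv f t l -> ccont f t.
Proof.
  intros H P HP. apply (ex_derive_continuous (V := C_R_NormedModule) f t).
  exists l; exact H. apply (proj2 (locally_C _ _)). exact HP.
Qed.

Lemma rderiv_comp (g : C -> C) (c : R -> C) (t : R) (l m : C) :
  cderiv g (c t) l -> rderiv c t m -> rderiv (fun s => g (c s)) t (l * m)%C.
Proof.
  intros Hg Hc. apply rderiv_spec. intros eps He.
  pose proof (Cmod_ge_0 l) as Hl. pose proof (Cmod_ge_0 m) as Hm.
  set (e1 := eps / 2 / (Cmod m + 1)).
  assert (He1 : 0 < e1) by (unfold e1; repeat apply Rdiv_lt_0_compat; lra).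
  destruct (proj1 (cderiv_spec _ _ _) Hg e1 He1) as [d [Hd H1]].
  (* The entry 1 bounds the increment of [c] by (|m| + 1) |s - t|; the other one keeps |l| times the
     error of [c] below eps / 2 times |s - t|. *)
  set (e2 := Rmin 1 (eps / 2 / (Cmod l + 1))).
  assert (He2 : 0 < e2).
  { unfold e2; apply Rmin_glb_lt; [lra|]. repeat apply Rdiv_lt_0_compat; lra. }
  destruct (proj1 (rderiv_spec _ _ _) Hc e2 He2) as [d2 [Hd2 H2]].
  destruct (proj1 (ccont_spec c t) (rderiv_ccont _ _ _ Hc) d Hd) as [d3 [Hd3 H3]].
  exists (Rmin d2 d3); split; [apply Rmin_glb_lt; lra|].
  intros s Hs.
  specialize (H2 s (Rlt_le_trans _ _ _ Hs (Rmin_l _ _))).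
  specialize (H1 (c s) (H3 s (Rlt_le_trans _ _ _ Hs (Rmin_r _ _)))).
  set (D := (c s - c t)%C) in *.
  set (h := Rabs (s - t)) in *.
  assert (Hh : 0 <= h) by apply Rabs_pos.
  assert (HD : Cmod D <= (Cmod m + 1) * h).
  { replace D with ((D - m * (s - t)%R) + m * (s - t)%R)%C by ring.
    eapply Rle_trans; [apply Cmod_triangle|]. rewrite Cmod_mult, Cmod_R. fold h.
    assert (e2 <= 1) by apply Rmin_l. nra. }
  replace (g (c s) - g (c t) - l * m * (s - t)%R)%C
    with ((g (c s) - g (c t) - l * D) + l * (D - m * (s - t)%R))%C by ring.
  eapply Rle_trans; [apply Cmod_triangle|]. rewrite Cmod_mult.
  assert (A1 : e1 * Cmod D <= eps / 2 * h).
  { apply Rle_trans with (e1 * ((Cmod m + 1) * h)).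
    apply Rmult_le_compat_l; lra. unfold e1. right; field; lra. }
  assert (A2 : Cmod l * Cmod (D - m * (s - t)%R) <= eps / 2 * h).
  { apply Rle_trans with (Cmod l * ((eps / 2 / (Cmod l + 1)) * h)).
    apply Rmult_le_compat_l; [lra|]. eapply Rle_trans; [exact H2|].
    apply Rmult_le_compat_r; [lra|]. apply Rmin_r.
    apply Rmult_le_reg_r with (Cmod l + 1); [lra|].
    field_simplify; [|lra]. nra. }
  lra.
Qed.

Lemma cderiv_eq (f : C -> C) (z l m : C) : cderiv f z l -> l = m -> cderiv f z m.
Proof. intros H <-; exact H. Qed.

Lemma cderiv_const (a z : C) : cderiv (fun _ => a) z 0.
Proof. exact (is_derive_const (K := C_AbsRing) (V := AbsRing_NormedModule C_AbsRing) a z). Qed.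

Lemma cderiv_id (z : C) : cderiv (fun w => w) z 1.
Proof. exact (is_derive_id (K := C_AbsRing) z). Qed.

Lemma cderiv_plus (f g : C -> C) (z l m : C) :
  cderiv f z l -> cderiv g z m -> cderiv (fun w => f w + g w)%C z (l + m)%C.
Proof. exact (is_derive_plus (V := AbsRing_NormedModule C_AbsRing) f g z l m). Qed.

Lemma cderiv_opp (f : C -> C) (z l : C) :
  cderiv f z l -> cderiv (fun w => - f w)%C z (- l)%C.
Proof. exact (is_derive_opp (V := AbsRing_NormedModule C_AbsRing) f z l). Qed.

Lemma cderiv_minus (f g : C -> C) (z l m : C) :
  cderiv f z l -> cderiv g z m -> cderiv (fun w => f w - g w)%C z (l - m)%C.
Proof. exact (is_derive_minus (V := AbsRing_NormedModule C_AbsRing) f g z l m). Qed.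

Lemma cderiv_mult (f g : C -> C) (z l m : C) :
  cderiv f z l -> cderiv g z m ->
  cderiv (fun w => f w * g w)%C z (l * g z + f z * m)%C.
Proof.
  intros Hf Hg.
  exact (is_derive_mult (K := C_AbsRing) f g z l m Hf Hg Cmult_comm).
Qed.

Lemma cderiv_comp (f g : C -> C) (z l m : C) :
  cderiv f (g z) l -> cderiv g z m -> cderiv (fun w => f (g w)) z (l * m)%C.
Proof.
  intros Hf Hg. eapply cderiv_eq.
  exact (is_derive_comp (V := AbsRing_NormedModule C_AbsRing) f g z l m Hf Hg).
  apply Cmult_comm.
Qed.

Lemma cderiv_ext_loc (f g : C -> C) (z l : C) (d : R) :
  0 < d -> (forall w, Cmod (w - z) < d -> f w = g w) -> cderiv f z l -> cderiv g z l.
Proof.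
  intros Hd H. apply (is_derive_ext_loc (V := AbsRing_NormedModule C_AbsRing)).
  exists (mkposreal d Hd). exact H.
Qed.

Lemma cderiv_unique (f : C -> C) (z l m : C) : cderiv f z l -> cderiv f z m -> l = m.
Proof.
  intros Hl Hm. apply cderiv_normed in Hl. apply cderiv_normed in Hm.
  rewrite <- (is_C_derive_unique _ _ _ Hl). exact (is_C_derive_unique _ _ _ Hm).
Qed.

Lemma Cmod_ge_minus (a b : C) : Cmod a - Cmod (a - b) <= Cmod b.
Proof.
  pose proof (Cmod_triangle (a - b) b).
  replace (a - b + b)%C with a in H by ring. lra.
Qed.

Lemma Cmod_minus_sym (a b : C) : Cmod (a - b) = Cmod (b - a).
Proof. rewrite <- Cmod_opp. f_equal. ring. Qed.

Lemma Cmod_pos_neq_0 (a : C) : 0 < Cmod a -> a <> 0.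
Proof. intros H. apply Cmod_gt_0. exact H. Qed.

Lemma cderiv_Cinv (z : C) : z <> 0 -> cderiv Cinv z (- / (z * z))%C.
Proof.
  intros Hz. apply cderiv_spec. intros eps He.
  assert (Z0 : 0 < Cmod z) by (apply Cmod_gt_0; exact Hz).
  (* The error is (w - z)^2 / (w z^2), and |w| >= |z| / 2 bounds the denominator below by |z|^3 /
     2. *)
  set (q := eps * (Cmod z * Cmod z * Cmod z) / 2).
  assert (Hq : 0 < q) by (unfold q; apply Rdiv_lt_0_compat; [|lra]; repeat apply Rmult_lt_0_compat; lra).
  exists (Rmin (Cmod z / 2) q); split; [apply Rmin_glb_lt; lra|].
  intros w Hw.
  assert (A := Rlt_le_trans _ _ _ Hw (Rmin_l _ _)).
  assert (B := Rlt_le_trans _ _ _ Hw (Rmin_r _ _)).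
  assert (W : Cmod z / 2 <= Cmod w).
  { pose proof (Cmod_ge_minus z w) as H. rewrite Cmod_minus_sym in H. lra. }
  assert (Hw0 : w <> 0) by (apply Cmod_pos_neq_0; lra).
  replace (/ w - / z - - / (z * z) * (w - z))%C
    with ((w - z) * ((w - z) / (w * (z * z))))%C by (field; auto).
  rewrite Cmod_mult, Rmult_comm. apply Rmult_le_compat_r; [apply Cmod_ge_0|].
  rewrite Cmod_div by (repeat apply Cmult_neq_0; auto). rewrite !Cmod_mult.
  apply Rle_trans with (q / (Cmod z / 2 * (Cmod z * Cmod z))).
  - apply Rmult_le_compat; [apply Cmod_ge_0| |lra|].
    + apply Rlt_le, Rinv_0_lt_compat. repeat apply Rmult_lt_0_compat; lra.
    + apply Rinv_le_contravar. repeat apply Rmult_lt_0_compat; lra.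
      apply Rmult_le_compat_r; [|lra]. nra.
  - unfold q. right; field. lra.
Qed.

Lemma cderiv_inv (f : C -> C) (z l : C) :
  f z <> 0 -> cderiv f z l -> cderiv (fun w => / f w)%C z (- l / (f z * f z))%C.
Proof.
  intros H0 H. eapply cderiv_eq.
  apply (cderiv_comp Cinv f z); [apply cderiv_Cinv; exact H0|exact H].
  field; exact H0.
Qed.

Lemma cderiv_pow (f : C -> C) (z l : C) (n : nat) :
  cderiv f z l -> cderiv (fun w => f w ^ n)%C z (INR n * f z ^ pred n * l)%C.
Proof.
  intros H. induction n as [|n IH].
  - simpl. eapply cderiv_eq; [apply cderiv_const|]. ring.
  - eapply cderiv_eq. apply (cderiv_mult f (fun w => f w ^ n)%C); [exact H|exact IH].
    rewrite S_INR, RtoC_plus. destruct n; simpl pred; [simpl INR; simpl Cpow; ring|].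
    cbv beta. rewrite !Cpow_S. ring.
Qed.

(** * Nested intervals and bisection of rectangles *)

Lemma pow_half_small (a d : R) : 0 < d -> exists n, a * (/ 2) ^ n < d.
Proof.
  intros Hd. destruct (Rle_lt_dec a 0) as [Ha|Ha].
  - exists 0%nat. simpl. lra.
  - destruct (pow_lt_1_zero (/ 2)) with (y := d / a) as [N HN].
    rewrite Rabs_pos_eq; lra. apply Rdiv_lt_0_compat; lra.
    exists N. specialize (HN N (le_n _)).
    rewrite Rabs_pos_eq in HN by (apply pow_le; lra).
    apply Rmult_lt_compat_l with (r := a) in HN; [|lra].
    replace (a * (d / a)) with d in HN by (field; lra). exact HN.
Qed.

(** The point is the supremum of the left end points, each of which lies below every right end
    point. *)
Lemma nested_point (a : nat -> R) (w : R) :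
  0 <= w -> (forall n, a n <= a (S n) /\ a (S n) + w * (/ 2) ^ S n <= a n + w * (/ 2) ^ n) ->
  exists x, forall n, a n <= x <= a n + w * (/ 2) ^ n.
Proof.
  intros Hw H.
  assert (P : forall n, 0 <= w * (/ 2) ^ n) by (intros n; apply Rmult_le_pos; [lra|apply pow_le; lra]).
  assert (M : forall n k, a n <= a (k + n)%nat /\ a (k + n)%nat + w * (/ 2) ^ (k + n) <= a n + w * (/ 2) ^ n).
  { intros n k; induction k as [|k IH]; simpl Nat.add; [split; lra|].
    specialize (H (k + n)%nat). split; lra. }
  assert (U : forall n m, a n <= a m + w * (/ 2) ^ m).
  { intros n m. destruct (le_ge_dec n m) as [L|L].
    - replace m with (m - n + n)%nat by lia. pose proof (M n (m - n)%nat).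
      pose proof (P (m - n + n)%nat). lra.
    - replace n with (n - m + m)%nat by lia. pose proof (M m (n - m)%nat).
      pose proof (P (n - m + m)%nat). lra. }
  destruct (completeness (fun y => exists n, y = a n)) as [x [Hx1 Hx2]].
  - exists (a 0%nat + w * (/ 2) ^ 0). intros y [n ->]. apply U.
  - exists (a 0%nat), 0%nat. reflexivity.
  - exists x. intros n. split.
    + apply Hx1. exists n; reflexivity.
    + apply Hx2. intros y [m ->]. apply U.
Qed.

(* The bisection half of Goursat's argument, for an arbitrary additive
   function [I] of rectangles [x, x + w] * [y, y + h]. *)
Lemma additive_rectangle_zero (I : R -> R -> R -> R -> C) (x0 y0 w0 h0 : R) :
  0 < w0 -> 0 < h0 ->
  (forall x y w h, x0 <= x -> x + w <= x0 + w0 -> y0 <= y -> y + h <= y0 + h0 ->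
    0 < w -> 0 < h ->
    I x y w h = (I x y (w / 2)%R (h / 2)%R + I (x + w / 2)%R y (w / 2)%R (h / 2)%R
      + I x (y + h / 2)%R (w / 2)%R (h / 2)%R + I (x + w / 2)%R (y + h / 2)%R (w / 2)%R (h / 2)%R)%C) ->
  (forall p q, x0 <= p <= x0 + w0 -> y0 <= q <= y0 + h0 ->
    forall eps, 0 < eps -> exists d, 0 < d /\
    forall x y w h, x0 <= x -> x + w <= x0 + w0 -> y0 <= y -> y + h <= y0 + h0 ->
      0 < w < d -> 0 < h < d -> x <= p <= x + w -> y <= q <= y + h ->
      Cmod (I x y w h) <= eps * (w + h) ^ 2) ->
  I x0 y0 w0 h0 = RtoC 0.
Proof.
  intros Hw Hh Hadd Hloc.
  destruct (Ceq_dec (I x0 y0 w0 h0) 0) as [E|E]; [exact E|exfalso].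
  apply Cmod_gt_0 in E.
  assert (Hs : 0 < (w0 + h0) ^ 2) by (apply pow_lt; lra).
  (* [k] is the ratio of |I| to the square of the half perimeter. That square is divided by four in
     a quarter, so a rectangle with ratio at least [k] contains a quarter of the same kind; the
     local bound with eps = k / 2 refutes this in the limit. *)
  set (k := Cmod (I x0 y0 w0 h0) / (w0 + h0) ^ 2).
  assert (Hk : 0 < k) by (apply Rdiv_lt_0_compat; lra).
  set (bad := fun x y w h => k * (w + h) ^ 2 <= Cmod (I x y w h)).
  (* The last quarter is taken without a test: if the other three fall below the ratio, additivity
     forces it to reach the ratio. *)
  set (step := fun (w h : R) (p : R * R) =>
    let (x, y) := p in
    if Rle_dec (k * (w / 2 + h / 2) ^ 2) (Cmod (I x y (w / 2) (h / 2))) then (x, y)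
    else if Rle_dec (k * (w / 2 + h / 2) ^ 2) (Cmod (I (x + w / 2) y (w / 2) (h / 2)))
    then (x + w / 2, y)
    else if Rle_dec (k * (w / 2 + h / 2) ^ 2) (Cmod (I x (y + h / 2) (w / 2) (h / 2)))
    then (x, y + h / 2)
    else (x + w / 2, y + h / 2)).
  set (S_ := fix s (n : nat) : R * R :=
     match n with O => (x0, y0) | S m => step (w0 * (/ 2) ^ m) (h0 * (/ 2) ^ m) (s m) end).
  assert (Pw : forall n, 0 < w0 * (/ 2) ^ n) by (intros n; apply Rmult_lt_0_compat; [lra|apply pow_lt; lra]).
  assert (Ph : forall n, 0 < h0 * (/ 2) ^ n) by (intros n; apply Rmult_lt_0_compat; [lra|apply pow_lt; lra]).
  assert (Inv : forall n,
     x0 <= fst (S_ n) /\ fst (S_ n) + w0 * (/ 2) ^ n <= x0 + w0 /\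
     y0 <= snd (S_ n) /\ snd (S_ n) + h0 * (/ 2) ^ n <= y0 + h0 /\
     bad (fst (S_ n)) (snd (S_ n)) (w0 * (/ 2) ^ n) (h0 * (/ 2) ^ n) /\
     (fst (S_ n) <= fst (S_ (S n)) /\ fst (S_ (S n)) + w0 * (/ 2) ^ S n <= fst (S_ n) + w0 * (/ 2) ^ n) /\
     (snd (S_ n) <= snd (S_ (S n)) /\ snd (S_ (S n)) + h0 * (/ 2) ^ S n <= snd (S_ n) + h0 * (/ 2) ^ n)).
  { assert (St : forall n x y, S_ n = (x, y) ->
       x0 <= x -> x + w0 * (/ 2) ^ n <= x0 + w0 -> y0 <= y -> y + h0 * (/ 2) ^ n <= y0 + h0 ->
       bad x y (w0 * (/ 2) ^ n) (h0 * (/ 2) ^ n) ->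
       bad (fst (S_ (S n))) (snd (S_ (S n))) (w0 * (/ 2) ^ S n) (h0 * (/ 2) ^ S n) /\
     (x <= fst (S_ (S n)) /\ fst (S_ (S n)) + w0 * (/ 2) ^ S n <= x + w0 * (/ 2) ^ n) /\
     (y <= snd (S_ (S n)) /\ snd (S_ (S n)) + h0 * (/ 2) ^ S n <= y + h0 * (/ 2) ^ n)).
    { intros n x y Hn A1 A2 A3 A4 B.
      change (S_ (S n)) with (step (w0 * (/ 2) ^ n) (h0 * (/ 2) ^ n) (S_ n)). rewrite Hn.
      pose proof (Pw n) as W. pose proof (Ph n) as H.
      replace (w0 * (/ 2) ^ S n) with (w0 * (/ 2) ^ n / 2) by (simpl; field).
      replace (h0 * (/ 2) ^ S n) with (h0 * (/ 2) ^ n / 2) by (simpl; field).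
      set (w := w0 * (/ 2) ^ n) in *. set (h := h0 * (/ 2) ^ n) in *.
      unfold step, bad in *.
      destruct Rle_dec as [D1|D1]; [simpl; repeat split; lra|].
      destruct Rle_dec as [D2|D2]; [simpl fst; simpl snd; repeat split; lra|].
      destruct Rle_dec as [D3|D3]; [simpl fst; simpl snd; repeat split; lra|].
      simpl fst; simpl snd.
      split; [|repeat split; lra].
      rewrite Hadd in B by lra.
      apply Rnot_le_lt in D1. apply Rnot_le_lt in D2. apply Rnot_le_lt in D3.
      match type of B with _ <= Cmod (?a + ?b + ?c + ?d)%C =>
        pose proof (Cmod_triangle (a + b + c) d);
        pose proof (Cmod_triangle (a + b) c);
        pose proof (Cmod_triangle a b) end.
      replace ((w / 2 + h / 2) ^ 2) with ((w + h) ^ 2 / 4) in * by field. lra. }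
    assert (A : forall n,
     x0 <= fst (S_ n) /\ fst (S_ n) + w0 * (/ 2) ^ n <= x0 + w0 /\
     y0 <= snd (S_ n) /\ snd (S_ n) + h0 * (/ 2) ^ n <= y0 + h0 /\
     bad (fst (S_ n)) (snd (S_ n)) (w0 * (/ 2) ^ n) (h0 * (/ 2) ^ n)).
    { induction n as [|n IH].
      - change (S_ 0%nat) with (x0, y0). simpl fst; simpl snd; simpl pow.
        rewrite !Rmult_1_r. repeat split; try lra.
        unfold bad, k. right; field. lra.
      - destruct IH as (I1 & I2 & I3 & I4 & I5).
        destruct (S_ n) as [x y] eqn:En. simpl fst in *. simpl snd in *.
        destruct (St n x y En I1 I2 I3 I4 I5) as (J1 & J2 & J3).
        repeat split; try lra. exact J1. }
    intros n. destruct (A n) as (I1 & I2 & I3 & I4 & I5).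
    pose proof (St n _ _ (surjective_pairing (S_ n)) I1 I2 I3 I4 I5) as (J1 & J2 & J3).
    do 5 (split; [assumption|]). split; assumption. }
  destruct (nested_point (fun n => fst (S_ n)) w0) as [p Hp]; [lra|intros n; apply Inv|].
  destruct (nested_point (fun n => snd (S_ n)) h0) as [q Hq]; [lra|intros n; apply Inv|].
  destruct (Hloc p q) with (eps := k / 2) as [d [Hd H]].
  - specialize (Hp 0%nat). simpl in Hp. lra.
  - specialize (Hq 0%nat). simpl in Hq. lra.
  - lra.
  - destruct (pow_half_small (w0 + h0) d Hd) as [n Hn].
    specialize (Inv n). destruct Inv as (I1 & I2 & I3 & I4 & I5 & _).
    pose proof (Pw n) as W. pose proof (Ph n) as H'.
    specialize (H (fst (S_ n)) (snd (S_ n)) (w0 * (/ 2) ^ n) (h0 * (/ 2) ^ n) I1 I2 I3 I4).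
    specialize (Hp n). specialize (Hq n).
    assert (H2 := H ltac:(lra) ltac:(lra) Hp Hq).
    unfold bad in I5.
    assert (0 < (w0 * (/ 2) ^ n + h0 * (/ 2) ^ n) ^ 2) by (apply pow_lt; lra).
    nra.
Qed.

(** * Curve integrals and Goursat's theorem *)

Definition is_cint (f : R -> C) (a b : R) (l : C) : Prop :=
  is_RInt (V := C_R_NormedModule) f a b l.

Definition cint (f : R -> C) (a b : R) : C :=
  RInt (V := C_R_CompleteNormedModule) f a b.

Lemma cint_correct (f : R -> C) (a b : R) :
  a <= b -> (forall t, a <= t <= b -> ccont f t) -> is_cint f a b (cint f a b).
Proof.
  intros Hab H. apply (RInt_correct (V := C_R_CompleteNormedModule)).
  apply (ex_RInt_continuous (V := C_R_CompleteNormedModule)).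
  intros t. rewrite Rmin_left, Rmax_right by lra. intros Ht.
  apply ccont_prod, H, Ht.
Qed.

Lemma is_cint_unique (f : R -> C) (a b : R) (l : C) : is_cint f a b l -> cint f a b = l.
Proof. exact (is_RInt_unique (V := C_R_CompleteNormedModule) f a b l). Qed.

Lemma is_cint_bound (f : R -> C) (a b : R) (l : C) (M : R) :
  a <= b -> (forall t, a <= t <= b -> Cmod (f t) <= M) -> is_cint f a b l ->
  Cmod l <= (b - a) * M.
Proof.
  intros Hab H Hl. rewrite Cmod_norm.
  apply (norm_RInt_le_const (V := C_R_NormedModule) f a b l M Hab); [|exact Hl].
  intros t Ht. rewrite <- Cmod_norm. apply H, Ht.
Qed.

Lemma is_cint_minus (f g : R -> C) (a b : R) (l m : C) :
  is_cint f a b l -> is_cint g a b m -> is_cint (fun t => f t - g t)%C a b (l - m)%C.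
Proof. exact (is_RInt_minus (V := C_R_NormedModule) f g a b l m). Qed.

Lemma is_cint_plus (f g : R -> C) (a b : R) (l m : C) :
  is_cint f a b l -> is_cint g a b m -> is_cint (fun t => f t + g t)%C a b (l + m)%C.
Proof. exact (is_RInt_plus (V := C_R_NormedModule) f g a b l m). Qed.

(** The integral is that of a real vector space, so a complex factor is carried through the real and
    imaginary parts. *)
Lemma is_cint_scal (f : R -> C) (a b : R) (k l : C) :
  is_cint f a b l -> is_cint (fun t => k * f t)%C a b (k * l)%C.
Proof.
  intros H. destruct k as [k1 k2], l as [l1 l2].
  pose proof (is_RInt_fct_extend_fst (U := R_NormedModule) (V := R_NormedModule) f a b (l1, l2) H) as H1.
  pose proof (is_RInt_fct_extend_snd (U := R_NormedModule) (V := R_NormedModule) f a b (l1, l2) H) as H2.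
  apply (is_RInt_fct_extend_pair (U := R_NormedModule) (V := R_NormedModule)).
  - exact (is_RInt_minus (V := R_NormedModule) _ _ _ _ _ _
      (is_RInt_scal (V := R_NormedModule) _ a b k1 _ H1) (is_RInt_scal (V := R_NormedModule) _ a b k2 _ H2)).
  - exact (is_RInt_plus (V := R_NormedModule) _ _ _ _ _ _
      (is_RInt_scal (V := R_NormedModule) _ a b k1 _ H2) (is_RInt_scal (V := R_NormedModule) _ a b k2 _ H1)).
Qed.

Lemma is_cint_deriv (F f : R -> C) (a b : R) :
  a <= b -> (forall t, a <= t <= b -> rderiv F t (f t)) ->
  (forall t, a <= t <= b -> ccont f t) -> is_cint f a b (F b - F a)%C.
Proof.
  intros Hab HF Hf.
  apply (is_RInt_derive (V := C_R_CompleteNormedModule) F f a b);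
    rewrite Rmin_left, Rmax_right by lra.
  - exact HF.
  - intros t Ht. apply ccont_prod, Hf, Ht.
Qed.

Lemma cint_chasles (f : R -> C) (a b c : R) :
  a <= b -> b <= c -> (forall t, a <= t <= c -> ccont f t) ->
  cint f a c = (cint f a b + cint f b c)%C.
Proof.
  intros Hab Hbc H. apply is_cint_unique.
  apply (is_RInt_Chasles (V := C_R_NormedModule) f a b c);
    apply cint_correct; try lra; intros t Ht; apply H; lra.
Qed.

Lemma rderiv_lipschitz (k dk : R -> C) (K : R) :
  (forall t, rderiv k t (dk t)) -> (forall t, ccont dk t) -> (forall t, Cmod (dk t) <= K) ->
  forall s t, Cmod (k s - k t) <= K * Rabs (s - t).
Proof.
  intros Hk Hc HK.
  assert (A : forall s t, t <= s -> Cmod (k s - k t) <= K * Rabs (s - t)).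
  { intros s t Hst. rewrite Rabs_pos_eq, Rmult_comm by lra.
    apply (is_cint_bound dk t s _ K Hst); [auto|].
    apply is_cint_deriv; auto. }
  intros s t. destruct (Rle_dec t s) as [H|H]; [apply A, H|].
  rewrite Cmod_minus_sym, Rabs_minus_sym. apply A. lra.
Qed.

(** The part [p] has the primitive [P] and integrates to the difference of its end values, so only
    [g - p] is left to estimate. *)
Lemma curve_integral_estimate (g P p : C -> C) (c dc : R -> C) (a b M : R) :
  a <= b ->
  (forall t, a <= t <= b -> rderiv c t (dc t)) ->
  (forall t, a <= t <= b -> ccont dc t) ->
  (forall t, a <= t <= b -> exists l, cderiv g (c t) l) ->
  (forall w, cderiv P w (p w)) -> (forall w, exists l, cderiv p w l) ->
  (forall t, a <= t <= b -> Cmod ((g (c t) - p (c t)) * dc t) <= M) ->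
  Cmod (cint (fun t => g (c t) * dc t)%C a b - (P (c b) - P (c a))) <= (b - a) * M.
Proof.
  intros Hab Hc Hdc Hg HP Hp HM.
  apply (is_cint_bound (fun t => (g (c t) * dc t) - p (c t) * dc t)%C a b _ M Hab).
  - intros t Ht. replace (g (c t) * dc t - p (c t) * dc t)%C with ((g (c t) - p (c t)) * dc t)%C by ring.
    apply HM, Ht.
  - apply is_cint_minus.
    + apply cint_correct; [exact Hab|]. intros t Ht. destruct (Hg t Ht) as [l Hl].
      apply ccont_mult; [|apply Hdc, Ht].
      apply ccont_comp with l; [exact Hl|]. eapply rderiv_ccont, Hc, Ht.
    + apply (is_cint_deriv (fun t => P (c t))); [exact Hab| |].
      * intros t Ht. apply rderiv_comp; [apply HP|apply Hc, Ht].
      * intros t Ht. destruct (Hp (c t)) as [l Hl].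
        apply ccont_mult; [|apply Hdc, Ht].
        apply ccont_comp with l; [exact Hl|]. eapply rderiv_ccont, Hc, Ht.
Qed.

Lemma rderiv_affine (z k : C) (t : R) : rderiv (fun s => z + RtoC s * k)%C t k.
Proof.
  apply rderiv_spec. intros eps He. exists 1; split; [lra|]. intros s _.
  replace (z + s * k - (z + t * k) - k * (s - t)%R)%C with (RtoC 0)
    by (rewrite RtoC_minus; ring).
  rewrite Cmod_0. pose proof (Rabs_pos (s - t)). nra.
Qed.

Lemma rderiv_affine_comp (z : C) (x : R) (k : R -> C) (t : R) (l : C) :
  rderiv k t l -> rderiv (fun s => z + RtoC x * k s)%C t (x * l)%C.
Proof.
  intros H. apply (rderiv_comp (fun w => z + RtoC x * w)%C k t x l); [|exact H].
  eapply cderiv_eq. apply cderiv_plus; [apply cderiv_const|].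
  apply cderiv_mult; [apply cderiv_const|apply cderiv_id]. cbv beta. ring.
Qed.

Lemma ccont_const (a : C) (t : R) : ccont (fun _ => a) t.
Proof. apply ccont_spec. intros eps He. exists 1; split; [lra|]. intros s _.
  replace (a - a)%C with (RtoC 0) by ring. rewrite Cmod_0. exact He.
Qed.

(* Goursat: the closed curves [z + lam k(th)], [lam] in [x0, 1], are homotopic
   through the domain of [g]. *)
Lemma homotopy_integral (g : C -> C) (z : C) (k dk : R -> C) (K x0 T : R) :
  0 <= x0 < 1 -> 0 < T ->
  (forall t, rderiv k t (dk t)) -> (forall t, ccont dk t) ->
  (forall t, Cmod (k t) <= K) -> (forall t, Cmod (dk t) <= K) ->
  k 0 = k T ->
  (forall x t, x0 <= x <= 1 -> 0 <= t <= T -> exists l, cderiv g (z + RtoC x * k t)%C l) ->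
  cint (fun t => g (z + RtoC x0 * k t) * (RtoC x0 * dk t))%C 0 T
  = cint (fun t => g (z + RtoC 1 * k t) * (RtoC 1 * dk t))%C 0 T.
Proof.
  intros Hx0 HT Hk Hdk HK HdK Hper Hg.
  (* [hp] and [vp] are the dx and dt components of the pullback of g(w) dw under (x, t) -> z + x
     k(t). [I] integrates this form around the boundary of a rectangle. *)
  set (hp := fun (y : R) (x : R) => (g (z + RtoC x * k y) * k y)%C).
  set (vp := fun (x : R) (t : R) => (g (z + RtoC x * k t) * (RtoC x * dk t))%C).
  set (I := fun x y w h =>
    (cint (hp y) x (x + w) + cint (vp (x + w)%R) y (y + h)
     - cint (hp (y + h)%R) x (x + w) - cint (vp x) y (y + h))%C).
  assert (K0 : 0 <= K) by (eapply Rle_trans; [apply Cmod_ge_0|apply (HK 0)]).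
  assert (Ch : forall y x, 0 <= y <= T -> x0 <= x <= 1 -> ccont (hp y) x).
  { intros y x Hy Hx. destruct (Hg x y Hx Hy) as [l Hl].
    apply ccont_mult; [|apply ccont_const].
    apply (ccont_comp g (fun x => z + RtoC x * k y)%C x l Hl).
    eapply rderiv_ccont, rderiv_affine. }
  assert (Cv : forall x t, 0 <= t <= T -> x0 <= x <= 1 -> ccont (vp x) t).
  { intros x t Ht Hx. destruct (Hg x t Hx Ht) as [l Hl].
    apply ccont_mult.
    - apply (ccont_comp g (fun t => z + RtoC x * k t)%C t l Hl).
      eapply rderiv_ccont, rderiv_affine_comp, Hk.
    - apply ccont_mult; [apply ccont_const|apply Hdk]. }
  assert (Z : I x0 0 (1 - x0) T = RtoC 0).
  { apply additive_rectangle_zero; try lra.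
    - intros x y w h H1 H2 H3 H4 Hw Hh. unfold I.
      replace (x + w / 2 + w / 2) with (x + w) by field.
      replace (y + h / 2 + h / 2) with (y + h) by field.
      rewrite (cint_chasles (hp y) x (x + w / 2) (x + w)) by (try lra; intros; apply Ch; lra).
      rewrite (cint_chasles (hp (y + h)%R) x (x + w / 2) (x + w)) by (try lra; intros; apply Ch; lra).
      rewrite (cint_chasles (vp x) y (y + h / 2) (y + h)) by (try lra; intros; apply Cv; lra).
      rewrite (cint_chasles (vp (x + w)%R) y (y + h / 2) (y + h)) by (try lra; intros; apply Cv; lra).
      ring.
    - intros p q Hp Hq eps He.
      destruct (Hg p q) as [l Hl]; try lra.
      set (u := (z + RtoC p * k q)%C) in *.
      (* A perimeter 2 (w + h), speed at most K and distance at most K (w + h) from [u] give the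
         total 2 e1 K^2 (w + h)^2. Using K + 1 avoids a division by zero. *)
      set (e1 := eps / (2 * (K + 1) * (K + 1))).
      assert (He1 : 0 < e1) by (apply Rdiv_lt_0_compat; nra).
      destruct (proj1 (cderiv_spec _ _ _) Hl e1 He1) as [d0 [Hd0 H0]].
      exists (d0 / (2 * (K + 1))). split; [apply Rdiv_lt_0_compat; lra|].
      intros x y w h H1 H2 H3 H4 Hw Hh Hpx Hqy.
      assert (Hd : K * (w + h) < d0).
      { assert (A : w + h < d0 / (K + 1)).
        { replace (d0 / (K + 1)) with (d0 / (2 * (K + 1)) + d0 / (2 * (K + 1))) by (field; lra). lra. }
        apply Rmult_lt_compat_r with (r := K + 1) in A; [|lra].
        replace (d0 / (K + 1) * (K + 1)) with d0 in A by (field; lra). nra. }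
      assert (Hdist : forall lam t, x <= lam <= x + w -> y <= t <= y + h ->
         Cmod (z + RtoC lam * k t - u) <= K * (w + h)).
      { intros lam t Hlam Ht. unfold u.
        replace (z + lam * k t - (z + p * k q))%C
          with ((lam - p)%R * k t + p * (k t - k q))%C by (rewrite RtoC_minus; ring).
        eapply Rle_trans; [apply Cmod_triangle|]. rewrite !Cmod_mult, !Cmod_R.
        pose proof (rderiv_lipschitz k dk K Hk Hdk HdK t q) as HL.
        assert (Rabs (lam - p) <= w) by (apply Rabs_le; lra).
        assert (Rabs (t - q) <= h) by (apply Rabs_le; lra).
        assert (A1 : Rabs (lam - p) * Cmod (k t) <= w * K).
        { apply Rmult_le_compat; auto using Rabs_pos, Cmod_ge_0. }
        assert (A2 : Rabs p * Cmod (k t - k q) <= 1 * (K * h)).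
        { apply Rmult_le_compat; auto using Rabs_pos, Cmod_ge_0.
          - apply Rabs_le; lra.
          - eapply Rle_trans; [exact HL|]. apply Rmult_le_compat_l; lra. }
        lra. }
      (* [pf] is the affine approximation of [g] at [u], and the four differences of its primitive
         [P] cancel around the rectangle. *)
      set (P := fun v : C => (g u * v + l * (/ 2) * ((v - u) * (v - u)))%C).
      set (pf := fun v : C => (g u + l * (v - u))%C).
      assert (HP : forall v, cderiv P v (pf v)).
      { intros v. eapply cderiv_eq.
        apply cderiv_plus. apply cderiv_mult; [apply cderiv_const|apply cderiv_id].
        apply cderiv_mult; [apply cderiv_const|].
        apply cderiv_mult; (apply cderiv_minus; [apply cderiv_id|apply cderiv_const]).
        unfold pf; cbv beta. field. }
      assert (Hpf : forall v, exists m, cderiv pf v m).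
      { intros v. eexists. apply cderiv_plus; [apply cderiv_const|].
        apply cderiv_mult; [apply cderiv_const|].
        apply cderiv_minus; [apply cderiv_id|apply cderiv_const]. }
      set (M := e1 * (K * (w + h)) * K).
      assert (HM : forall lam t v, x <= lam <= x + w -> y <= t <= y + h -> Cmod v <= K ->
        Cmod ((g (z + RtoC lam * k t) - pf (z + RtoC lam * k t)) * v)%C <= M).
      { intros lam t v Hlam Ht Hv. specialize (Hdist lam t Hlam Ht).
        rewrite Cmod_mult. unfold M. apply Rmult_le_compat; auto using Cmod_ge_0.
        unfold pf.
        replace (g (z + lam * k t) - (g u + l * (z + lam * k t - u)))%C
          with (g (z + lam * k t) - g u - l * (z + lam * k t - u))%C by ring.
        eapply Rle_trans; [apply H0; lra|]. apply Rmult_le_compat_l; lra. }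
      assert (HV : forall x', x <= x' <= x + w ->
         Cmod (cint (vp x') y (y + h) - (P (z + RtoC x' * k (y + h)%R) - P (z + RtoC x' * k y)))%C <= h * M).
      { intros x' Hx'. replace (h * M) with ((y + h - y) * M) by ring.
        apply (curve_integral_estimate g P pf (fun t => z + RtoC x' * k t)%C (fun t => RtoC x' * dk t)%C); try lra; auto.
        - intros t Ht. apply rderiv_affine_comp, Hk.
        - intros t Ht. apply ccont_mult; [apply ccont_const|apply Hdk].
        - intros t Ht. apply Hg; lra.
        - intros t Ht. apply HM; try lra. rewrite Cmod_mult, Cmod_R, Rabs_pos_eq by lra.
          specialize (HdK t). pose proof (Cmod_ge_0 (dk t)). nra. }
      assert (HH : forall y', y <= y' <= y + h ->
         Cmod (cint (hp y') x (x + w) - (P (z + RtoC (x + w)%R * k y') - P (z + RtoC x * k y')))%C <= w * M).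
      { intros y' Hy'. replace (w * M) with ((x + w - x) * M) by ring.
        apply (curve_integral_estimate g P pf (fun t => z + RtoC t * k y')%C (fun t => k y')%C); try lra; auto.
        - intros t Ht. apply rderiv_affine.
        - intros t Ht. apply ccont_const.
        - intros t Ht. apply Hg; lra. }
      unfold I.
      pose proof (HV x ltac:(lra)) as E1. pose proof (HV (x + w) ltac:(lra)) as E2.
      pose proof (HH y ltac:(lra)) as E3. pose proof (HH (y + h) ltac:(lra)) as E4.
      apply Rle_trans with (2 * (w + h) * M).
      + match type of E1 with Cmod ?a <= _ => set (a1 := a) in * end.
        match type of E2 with Cmod ?a <= _ => set (a2 := a) in * end.
        match type of E3 with Cmod ?a <= _ => set (a3 := a) in * end.
        match type of E4 with Cmod ?a <= _ => set (a4 := a) in * end.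
        replace (cint (hp y) x (x + w) + cint (vp (x + w)%R) y (y + h) -
           cint (hp (y + h)%R) x (x + w) - cint (vp x) y (y + h))%C
          with (a3 + a2 - a4 - a1)%C by (unfold a1, a2, a3, a4; ring).
        unfold Cminus. eapply Rle_trans; [apply Cmod_triangle|].
        eapply Rle_trans; [apply Rplus_le_compat_r, Cmod_triangle|].
        eapply Rle_trans; [apply Rplus_le_compat_r, Rplus_le_compat_r, Cmod_triangle|].
        rewrite !Cmod_opp. lra.
      + unfold M, e1.
        replace (2 * (w + h) * (eps / (2 * (K + 1) * (K + 1)) * (K * (w + h)) * K))
          with (eps * (w + h) ^ 2 * ((K * K) / ((K + 1) * (K + 1)))) by (field; lra).
        rewrite <- (Rmult_1_r (eps * (w + h) ^ 2)) at 2.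
        apply Rmult_le_compat_l.
        * apply Rmult_le_pos; [lra|]. apply pow_le; lra.
        * apply Rmult_le_reg_r with ((K + 1) * (K + 1)); [nra|].
          field_simplify; [|lra]. nra. }
  unfold I in Z.
  replace (x0 + (1 - x0)) with 1 in Z by ring. rewrite Rplus_0_l in Z.
  (* As the curve is closed, the two horizontal sides cancel, and the vanishing boundary integral
     equates the two vertical ones. *)
  assert (Eh : hp 0 = hp T) by (unfold hp; rewrite Hper; reflexivity).
  rewrite Eh in Z. fold (vp x0). fold (vp 1).
  symmetry. apply Ceq_minus. rewrite <- Z. ring.
Qed.

(** * Cauchy's formula and Taylor coefficients *)

Ltac ceq := match goal with |- ?a = ?b => change (@eq C a b) end.

Definition cseries (a : nat -> C) (l : C) : Prop :=
  is_series (K := C_AbsRing) (V := C_NormedModule) a l.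

Notation csum a := (sum_n (G := C_AbelianGroup) a).

Lemma csum_S (a : nat -> C) (n : nat) : csum a (S n) = (csum a n + a (S n))%C.
Proof. exact (sum_Sn (G := C_AbelianGroup) a n). Qed.

Lemma csum_O (a : nat -> C) : csum a 0 = a 0%nat.
Proof. exact (sum_O (G := C_AbelianGroup) a). Qed.

Lemma cseries_spec (a : nat -> C) (l : C) :
  cseries a l <-> forall eps, 0 < eps -> exists N, forall n, (N <= n)%nat -> Cmod (csum a n - l) < eps.
Proof.
  split.
  - intros H eps He.
    apply (H (fun y : C => Cmod (y - l) < eps)).
    apply (proj2 (locally_C _ _)). exists (mkposreal eps He). intros y Hy; exact Hy.
  - intros H P HP. apply (proj1 (locally_C _ _)) in HP. destruct HP as [e He].
    destruct (H e (cond_pos e)) as [N HN]. exists N. intros n Hn. apply He. exact (HN n Hn).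
Qed.

Lemma cseries_unique (a : nat -> C) (l m : C) : cseries a l -> cseries a m -> l = m.
Proof.
  intros Hl Hm. apply Ceq_minus. destruct (Ceq_dec (l - m) 0) as [E|E]; [exact E|exfalso].
  apply Cmod_gt_0 in E.
  destruct (proj1 (cseries_spec a l) Hl (Cmod (l - m) / 2)) as [N HN]; [lra|].
  destruct (proj1 (cseries_spec a m) Hm (Cmod (l - m) / 2)) as [N' HN']; [lra|].
  specialize (HN (max N N') (Nat.le_max_l _ _)). specialize (HN' (max N N') (Nat.le_max_r _ _)).
  set (s := csum a (max N N')) in *.
  pose proof (Cmod_triangle (l - s) (s - m)) as T.
  replace (l - s + (s - m))%C with (l - m)%C in T by ring.
  rewrite (Cmod_minus_sym l s) in T. lra.
Qed.

Lemma cseries_ext (a b : nat -> C) (l : C) : (forall n, a n = b n) -> cseries a l -> cseries b l.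
Proof. intros H. exact (is_series_ext (V := C_NormedModule) a b l H). Qed.

Lemma cseries_scal (a : nat -> C) (l k : C) :
  cseries a l -> cseries (fun n => k * a n)%C (k * l)%C.
Proof. exact (is_series_scal (V := C_NormedModule) k a l). Qed.

Lemma cseries_minus (a b : nat -> C) (l m : C) :
  cseries a l -> cseries b m -> cseries (fun n => a n - b n)%C (l - m)%C.
Proof. exact (is_series_minus (V := C_NormedModule) a b l m). Qed.

Lemma cseries_single (a l : C) :
  a = l -> cseries (fun n => match n with O => a | S _ => RtoC 0 end) l.
Proof.
  intros <-. apply cseries_spec. intros eps He. exists 0%nat. intros n _.
  replace (csum _ n) with a.
  - replace (a - a)%C with (RtoC 0) by ring. rewrite Cmod_0. exact He.
  - induction n as [|n IH]; [rewrite csum_O; reflexivity|].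
    rewrite csum_S, <- IH. ring.
Qed.

Lemma geom_small (q B eps : R) : 0 <= q < 1 -> 0 <= B -> 0 < eps ->
  exists N, forall n, (N <= n)%nat -> B * q ^ n < eps.
Proof.
  intros Hq HB He.
  destruct (pow_lt_1_zero q) with (y := eps / (B + 1)) as [N HN].
  rewrite Rabs_pos_eq; lra. apply Rdiv_lt_0_compat; lra.
  exists N. intros n Hn. specialize (HN n Hn).
  rewrite Rabs_pos_eq in HN by (apply pow_le; lra).
  apply Rle_lt_trans with (B * (eps / (B + 1))).
  - apply Rmult_le_compat_l; lra.
  - apply Rmult_lt_reg_r with (B + 1); [lra|]. field_simplify; [|lra]. nra.
Qed.

(** The [r n] are the tails: the recursion telescopes to a partial sum plus a tail, which is
    geometrically small. In this form no sum is interchanged with an integral. *)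
Lemma cseries_remainder (a r : nat -> C) (q B : R) :
  0 <= q < 1 -> 0 <= B -> (forall n, r n = (a n + r (S n))%C) ->
  (forall n, Cmod (r n) <= B * q ^ n) -> cseries a (r 0%nat).
Proof.
  intros Hq HB Hr Hb. apply cseries_spec. intros eps He.
  destruct (geom_small q B eps Hq HB He) as [N HN].
  assert (S : forall n, r 0%nat = (csum a n + r (S n))%C).
  { induction n as [|n IH]; [rewrite csum_O; apply Hr|].
    rewrite csum_S, IH, (Hr (S n)). ring. }
  exists N. intros n Hn. rewrite (S n).
  replace (csum a n - (csum a n + r (Datatypes.S n)))%C with (- r (Datatypes.S n))%C by ring.
  rewrite Cmod_opp. eapply Rle_lt_trans; [apply Hb|]. apply HN. lia.
Qed.

Definition circ (r t : R) : C := (RtoC r * (cos t, sin t))%C.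

Lemma circ_mod (r t : R) : 0 <= r -> Cmod (circ r t) = r.
Proof.
  intros Hr. unfold circ. rewrite Cmod_mult, Cmod_R, Rabs_pos_eq by lra.
  unfold Cmod; simpl. replace (cos t * (cos t * 1) + sin t * (sin t * 1)) with 1.
  rewrite sqrt_1; ring. pose proof (sin2_cos2 t). unfold Rsqr in H. lra.
Qed.

Lemma circ_neq_0 (r t : R) : 0 < r -> circ r t <> 0.
Proof. intros Hr. apply Cmod_pos_neq_0. rewrite circ_mod; lra. Qed.

Lemma circ_scale (r R t : R) : circ (r * R) t = (RtoC r * circ R t)%C.
Proof. unfold circ. rewrite RtoC_mult. ring. Qed.

Lemma circ_period (r : R) : circ r 0 = circ r (2 * PI).
Proof. unfold circ. rewrite cos_2PI, sin_2PI, cos_0, sin_0. reflexivity. Qed.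

Lemma rderiv_pair (f g : R -> R) (t l m : R) :
  is_derive f t l -> is_derive g t m -> rderiv (fun s => (f s, g s)) t (l, m).
Proof.
  intros Hf Hg.
  exact (filterdiff_comp_2 (F := locally t) (fun s => f s) (fun s => g s)
     (fun a b => (a, b) : prod_NormedModule _ R_NormedModule R_NormedModule)
     _ _ (fun a b => (a, b)) Hf Hg
     (filterdiff_linear _ (is_linear_prod _ _ is_linear_fst is_linear_snd))).
Qed.

Lemma rderiv_circ (r t : R) : rderiv (circ r) t (Ci * circ r t)%C.
Proof.
  unfold circ.
  replace (Ci * (RtoC r * (cos t, sin t)))%C with (RtoC r * (- sin t, cos t)%R)%C.
  - apply (rderiv_comp (fun w => RtoC r * w)%C (fun t => (cos t, sin t))).
    + eapply cderiv_eq. apply cderiv_mult; [apply cderiv_const|apply cderiv_id]. cbv beta. ring.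
    + apply rderiv_pair; [apply is_derive_cos|apply is_derive_sin].
  - unfold Cmult, RtoC, Ci; simpl. f_equal; ring.
Qed.

Lemma ccont_circ (r t : R) : ccont (circ r) t.
Proof. eapply rderiv_ccont, rderiv_circ. Qed.

Lemma ccont_inv (f : R -> C) (t : R) : f t <> 0 -> ccont f t -> ccont (fun s => / f s)%C t.
Proof. intros H0 H. eapply (ccont_comp Cinv); [apply cderiv_Cinv, H0|exact H]. Qed.

Lemma ccont_pow (f : R -> C) (t : R) (n : nat) : ccont f t -> ccont (fun s => f s ^ n)%C t.
Proof. intros H. eapply (ccont_comp (fun w => w ^ n)%C); [apply (cderiv_pow (fun w => w)), cderiv_id|exact H]. Qed.

Lemma ccont_minus (f g : R -> C) (t : R) :
  ccont f t -> ccont g t -> ccont (fun s => f s - g s)%C t.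
Proof.
  intros Hf Hg.
  exact (continuous_minus (V := AbsRing_NormedModule C_AbsRing) f g t Hf Hg).
Qed.

Definition holo (R : R) (f : C -> C) : Prop :=
  forall w, Cmod w < R -> exists l, cderiv f w l.

Lemma circ_minus_ge (r t : R) (z : C) : 0 <= r -> r - Cmod z <= Cmod (circ r t - z).
Proof.
  intros Hr. pose proof (Cmod_ge_minus (circ r t) (circ r t - z)) as H.
  replace (circ r t - (circ r t - z))%C with z in H by ring.
  rewrite circ_mod in H by lra. lra.
Qed.

(** The circle is contracted to [z] along k(t) = circ r t - z. Since dk / k does not depend on the
    scale x, the integral of f(z + x k) dk / k is the same for all 0 < x <= 1, and continuity of [f]
    at [z] determines it as x tends to 0. *)
Lemma cauchy_kernel (f : C -> C) (z : C) (r R : R) :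
  holo R f -> Cmod z < r < R ->
  cint (fun t => f (circ r t) * (Ci * circ r t / (circ r t - z)))%C 0 (2 * PI)
  = (f z * cint (fun t => Ci * circ r t / (circ r t - z))%C 0 (2 * PI))%C.
Proof.
  intros Hf Hr. pose proof PI_RGT_0 as HPI. pose proof (Cmod_ge_0 z) as Hz.
  set (k := fun t => (circ r t - z)%C). set (dk := fun t => (Ci * circ r t)%C).
  set (q := fun t => (dk t / k t)%C).
  assert (Hkge : forall t, r - Cmod z <= Cmod (k t)) by (intros t; apply circ_minus_ge; lra).
  assert (Hk0 : forall t, k t <> 0) by (intros t; apply Cmod_pos_neq_0; specialize (Hkge t); lra).
  assert (Hin : forall x t, 0 <= x <= 1 -> Cmod (z + RtoC x * k t) < R).
  { intros x t Hx. unfold k.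
    replace (z + x * (circ r t - z))%C with ((1 - x)%R * z + x * circ r t)%C by (rewrite RtoC_minus; ring).
    eapply Rle_lt_trans; [apply Cmod_triangle|]. rewrite !Cmod_mult, !Cmod_R, circ_mod by lra.
    rewrite !Rabs_pos_eq by lra. nra. }
  assert (Hdk : forall t, rderiv k t (dk t)).
  { intros t.
    pose proof (rderiv_comp (fun w => w - z)%C (circ r) t _ _
      (cderiv_minus _ _ _ _ _ (cderiv_id _) (cderiv_const z _)) (rderiv_circ r t)) as H.
    replace (dk t) with ((1 - 0) * (Ci * circ r t))%C by (unfold dk; ring). exact H. }
  assert (Cdk : forall t, ccont dk t) by (intros t; apply ccont_mult; [apply ccont_const|apply ccont_circ]).
  assert (Cq : forall t, ccont q t).
  { intros t. apply ccont_mult; [apply Cdk|]. apply ccont_inv; [apply Hk0|].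
    eapply rderiv_ccont, Hdk. }
  assert (Hmdk : forall t, Cmod (dk t) = r).
  { intros t. unfold dk. rewrite Cmod_mult, Cmod_Ci, circ_mod; lra. }
  assert (Bq : forall t, Cmod (q t) <= r / (r - Cmod z)).
  { intros t. unfold q. rewrite Cmod_div by apply Hk0. rewrite Hmdk.
    apply Rmult_le_compat_l; [lra|]. apply Rinv_le_contravar; [lra|apply Hkge]. }
  assert (Cf : forall x t, 0 <= x <= 1 -> ccont (fun t => f (z + RtoC x * k t))%C t).
  { intros x t Hx. destruct (Hf _ (Hin x t Hx)) as [l Hl].
    apply (ccont_comp f (fun t => z + RtoC x * k t)%C t l Hl).
    eapply rderiv_ccont, rderiv_affine_comp, Hdk. }
  assert (Hom : forall x, 0 < x < 1 ->
     cint (fun t => f (z + RtoC x * k t) * q t)%C 0 (2 * PI)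
     = cint (fun t => f (z + RtoC 1 * k t) * q t)%C 0 (2 * PI)).
  { intros x Hx.
    pose proof (homotopy_integral (fun u => f u * / (u - z))%C z k dk (r + Cmod z) x (2 * PI)) as H.
    assert (E : forall y, 0 < y <= 1 ->
       cint (fun t => f (z + RtoC y * k t) * / (z + RtoC y * k t - z) * (RtoC y * dk t))%C 0 (2 * PI)
       = cint (fun t => f (z + RtoC y * k t) * q t)%C 0 (2 * PI)).
    { intros y Hy. apply (RInt_ext (V := C_R_CompleteNormedModule)). intros t _.
      change (f (z + RtoC y * k t) * / (z + RtoC y * k t - z) * (RtoC y * dk t)
        = f (z + RtoC y * k t) * q t)%C.
      replace (z + RtoC y * k t - z)%C with (RtoC y * k t)%C by ring.
      unfold q. field. split; [apply Hk0|]. intros A. apply RtoC_inj in A. lra. }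
    rewrite <- !E by lra. apply H; auto; try lra.
    - intros t. unfold k, Cminus. eapply Rle_trans; [apply Cmod_triangle|].
      rewrite Cmod_opp, circ_mod; lra.
    - intros t. rewrite Hmdk. lra.
    - unfold k. rewrite circ_period. reflexivity.
    - intros y t Hy _. destruct (Hf _ (Hin y t ltac:(lra))) as [l Hl].
      eexists. apply cderiv_mult; [exact Hl|].
      apply (cderiv_inv (fun u => u - z)%C).
      + replace (z + y * k t - z)%C with (y * k t)%C by ring.
        apply Cmult_neq_0; [|apply Hk0]. intros A. apply RtoC_inj in A. lra.
      + apply cderiv_minus; [apply cderiv_id|apply cderiv_const]. }
  assert (E1 : cint (fun t => f (circ r t) * (Ci * circ r t / (circ r t - z)))%C 0 (2 * PI)
     = cint (fun t => f (z + RtoC 1 * k t) * q t)%C 0 (2 * PI)).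
  { apply (RInt_ext (V := C_R_CompleteNormedModule)). intros t _. unfold q, k, dk.
    replace (z + 1 * (circ r t - z))%C with (circ r t) by ring. reflexivity. }
  rewrite E1. fold q. change (fun t => (Ci * circ r t / (circ r t - z))%C) with q.
  apply Ceq_minus.
  set (D := (_ - _)%C). destruct (Ceq_dec D 0) as [E|E]; [exact E|exfalso].
  apply Cmod_gt_0 in E.
  (* [Q] bounds the integral of |q|. A curve on which [f] is within |D| / (2 Q) of [f z] then gives
     |D| <= |D| / 2. *)
  set (Q := 2 * PI * (r / (r - Cmod z))).
  assert (HQ : 0 < Q) by (unfold Q; apply Rmult_lt_0_compat; [lra|apply Rdiv_lt_0_compat; lra]).
  destruct (Hf z ltac:(lra)) as [l Hl].
  destruct (cderiv_continuous_spec f z l Hl (Cmod D / 2 / Q)) as [d [Hd Hc]].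
  { apply Rdiv_lt_0_compat; lra. }
  set (x := Rmin (/ 2) (d / (2 * (r + Cmod z)))).
  assert (Hx : 0 < x) by (apply Rmin_glb_lt; [lra|apply Rdiv_lt_0_compat; lra]).
  assert (Hx2 : x <= / 2) by apply Rmin_l.
  assert (HD : D = (cint (fun t => f (z + RtoC x * k t) * q t)%C 0 (2 * PI) - f z * cint q 0 (2 * PI))%C).
  { unfold D. rewrite (Hom x) by lra. reflexivity. }
  assert (B : Cmod D <= (2 * PI - 0) * (Cmod D / 2 / Q * (r / (r - Cmod z)))).
  { rewrite HD at 1.
    apply (is_cint_bound (fun t => f (z + RtoC x * k t) * q t - f z * q t)%C); [lra| |].
    - intros t _. replace (f (z + x * k t) * q t - f z * q t)%C with ((f (z + x * k t) - f z) * q t)%C by ring.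
      rewrite Cmod_mult. apply Rmult_le_compat; auto using Cmod_ge_0.
      apply Rlt_le, Hc. replace (z + x * k t - z)%C with (x * k t)%C by ring.
      rewrite Cmod_mult, Cmod_R, Rabs_pos_eq by lra.
      apply Rle_lt_trans with (d / (2 * (r + Cmod z)) * (r + Cmod z)).
      + apply Rmult_le_compat; try lra. apply Cmod_ge_0. apply Rmin_r.
        unfold k, Cminus. eapply Rle_trans; [apply Cmod_triangle|].
        rewrite Cmod_opp, circ_mod; lra.
      + replace (d / (2 * (r + Cmod z)) * (r + Cmod z)) with (d / 2) by (field; lra). lra.
    - apply is_cint_minus.
      + apply cint_correct; [lra|]. intros t _. apply ccont_mult; [apply Cf; lra|apply Cq].
      + apply is_cint_scal. apply cint_correct; [lra|]. intros t _. apply Cq. }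
  replace ((2 * PI - 0) * (Cmod D / 2 / Q * (r / (r - Cmod z)))) with (Cmod D / 2) in B.
  lra. unfold Q. field. repeat split; lra.
Qed.

(** The kernel is expanded in a geometric series with ratio z / circ r t, and the integrals of its
    tails [rm n] satisfy [cseries_remainder]. With phi = 1 this evaluates the kernel integral, with
    phi the values of [f] it produces the Taylor series. *)
Lemma kernel_expansion (phi : R -> C) (z : C) (r M : R) :
  Cmod z < r -> (forall t, ccont phi t) ->
  (forall t, 0 <= t <= 2 * PI -> Cmod (phi t) <= M) ->
  cseries (fun n => z ^ n * cint (fun t => phi t * (Ci / circ r t ^ n)) 0 (2 * PI))%C
    (cint (fun t => phi t * (Ci * circ r t / (circ r t - z)))%C 0 (2 * PI)).
Proof.
  intros Hr Hc HM. pose proof PI_RGT_0 as HPI. pose proof (Cmod_ge_0 z) as Hz.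
  assert (M0 : 0 <= M) by (eapply Rle_trans; [apply Cmod_ge_0|apply (HM 0); lra]).
  assert (Hk0 : forall t, (circ r t - z)%C <> 0).
  { intros t. apply Cmod_pos_neq_0. pose proof (circ_minus_ge r t z). lra. }
  set (rm := fun n t => (phi t * ((z / circ r t) ^ n * (Ci * circ r t / (circ r t - z))))%C).
  assert (Crm : forall n t, ccont (rm n) t).
  { intros n t. apply ccont_mult; [apply Hc|]. apply ccont_mult.
    - apply ccont_pow. apply ccont_mult; [apply ccont_const|].
      apply ccont_inv; [apply circ_neq_0; lra|apply ccont_circ].
    - apply ccont_mult; [apply ccont_mult; [apply ccont_const|apply ccont_circ]|].
      apply ccont_inv; [apply Hk0|]. apply ccont_minus; [apply ccont_circ|apply ccont_const]. }
  assert (Irm : forall n, is_cint (rm n) 0 (2 * PI) (cint (rm n) 0 (2 * PI))).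
  { intros n. apply cint_correct; [lra|auto]. }
  assert (E0 : cint (fun t => phi t * (Ci * circ r t / (circ r t - z)))%C 0 (2 * PI) = cint (rm 0%nat) 0 (2 * PI)).
  { apply (RInt_ext (V := C_R_CompleteNormedModule)). intros t _. unfold rm. simpl Cpow.
    rewrite Cmult_1_l. reflexivity. }
  rewrite E0.
  apply (cseries_remainder _ (fun n => cint (rm n) 0 (2 * PI)) (Cmod z / r) (2 * PI * (M * (r / (r - Cmod z))))).
  - split; [apply Rdiv_le_0_compat; lra|]. apply Rmult_lt_reg_r with r; [lra|]. field_simplify; lra.
  - apply Rmult_le_pos; [lra|]. apply Rmult_le_pos; [lra|]. apply Rdiv_le_0_compat; lra.
  - intros n. apply is_cint_unique.
    eapply (is_RInt_ext (V := C_R_NormedModule)); [|apply (is_cint_plus (fun t => z ^ n * (phi t * (Ci / circ r t ^ n)))%C (rm (S n)))].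
    + intros t _. unfold rm.
      assert (circ r t <> 0) by (apply circ_neq_0; lra).
      unfold Cdiv at 2 3 4. rewrite !Cpow_mult_l, !Cpow_inv, !Cpow_S by assumption.
      assert ((circ r t ^ n)%C <> 0) by (apply Cpow_nz; assumption).
      ceq. field. auto.
    + apply is_cint_scal, cint_correct; [lra|]. intros t _. apply ccont_mult; [apply Hc|].
      apply ccont_mult; [apply ccont_const|].
      apply ccont_inv; [apply Cpow_nz, circ_neq_0; lra|]. apply ccont_pow, ccont_circ.
    + apply Irm.
  - intros n.
    replace (2 * PI * (M * (r / (r - Cmod z))) * (Cmod z / r) ^ n)
      with ((2 * PI - 0) * (M * ((Cmod z / r) ^ n * (r / (r - Cmod z))))) by ring.
    apply (is_cint_bound (rm n)); [lra| |apply Irm].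
    intros t Ht. unfold rm. rewrite !Cmod_mult, Cmod_pow.
    rewrite (Cmod_div z) by (apply circ_neq_0; lra).
    rewrite (Cmod_div (Ci * circ r t)) by apply Hk0.
    rewrite Cmod_mult, Cmod_Ci, circ_mod, Rmult_1_l by lra.
    apply Rmult_le_compat; auto using Cmod_ge_0.
    + apply Rmult_le_pos; [apply pow_le, Rdiv_le_0_compat; lra|].
      apply Rdiv_le_0_compat; [lra|]. apply Cmod_gt_0, Hk0.
    + apply Rmult_le_compat_l; [apply pow_le, Rdiv_le_0_compat; lra|].
      apply Rmult_le_compat_l; [lra|]. apply Rinv_le_contravar; [lra|].
      apply circ_minus_ge; lra.
Qed.

(** Only the constant term of the expansion with phi = 1 survives: for n > 0 the integrand i /
    circ^n has the periodic primitive - 1 / (n circ^n). *)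
Lemma kernel_one (z : C) (r : R) :
  Cmod z < r -> cint (fun t => Ci * circ r t / (circ r t - z))%C 0 (2 * PI) = (2 * PI * Ci)%C.
Proof.
  intros Hr. pose proof PI_RGT_0 as HPI. pose proof (Cmod_ge_0 z) as Hz.
  assert (H1 := kernel_expansion (fun _ => RtoC 1) z r 1 Hr (fun t => ccont_const _ _)
    (fun _ _ => Req_le _ _ Cmod_1)).
  replace (cint (fun t => Ci * circ r t / (circ r t - z))%C 0 (2 * PI))
    with (cint (fun t => RtoC 1 * (Ci * circ r t / (circ r t - z)))%C 0 (2 * PI)).
  2:{ apply (RInt_ext (V := C_R_CompleteNormedModule)). intros t _. apply Cmult_1_l. }
  apply (cseries_unique _ _ _ H1).
  apply (cseries_ext (fun n => match n with O => (2 * PI * Ci)%C | S _ => RtoC 0 end)).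
  2:{ apply cseries_single; reflexivity. }
  intros [|n].
  - rewrite (is_cint_unique _ _ _ (2 * PI * Ci)%C); [simpl; ring|].
    eapply (is_RInt_ext (V := C_R_NormedModule) (fun _ => Ci)).
    + intros t _. simpl Cpow. ceq. field.
    + replace (2 * PI * Ci)%C with ((2 * PI - 0)%R * Ci)%C by (rewrite RtoC_minus, RtoC_mult; ring).
      rewrite <- scal_R_Cmult. exact (is_RInt_const (V := C_R_NormedModule) 0 (2 * PI) Ci).
  - rewrite (is_cint_unique _ _ _ (RtoC 0)); [ring|].
    set (F := fun t => (- / INR (S n) * / circ r t ^ S n)%C).
    replace (RtoC 0) with (F (2 * PI)%R - F 0%R)%C.
    2:{ unfold F. rewrite (circ_period r). ring. }
    assert (N0 : RtoC (INR (S n)) <> 0).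
    { intros A. apply RtoC_inj in A. revert A. apply not_0_INR. lia. }
    apply is_cint_deriv; [lra| |].
    + intros t _.
      assert (A0 : circ r t <> 0) by (apply circ_neq_0; lra).
      pose proof (rderiv_comp (fun w => - / INR (S n) * / w ^ S n)%C (circ r) t _ _
        (cderiv_mult _ _ _ _ _ (cderiv_const (- / INR (S n))%C _)
          (cderiv_inv (fun w => w ^ S n)%C _ _ (Cpow_nz _ _ A0)
            (cderiv_pow (fun w => w) _ _ (S n) (cderiv_id _)))) (rderiv_circ r t)) as H.
      match type of H with rderiv _ _ ?a => replace (1 * (Ci / circ r t ^ S n))%C with a; [exact H|] end.
      simpl pred. rewrite !Cpow_S.
      assert ((circ r t ^ n)%C <> 0) by (apply Cpow_nz; assumption).
      field. auto.
    + intros t _. apply ccont_mult; [apply ccont_const|]. apply ccont_mult; [apply ccont_const|].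
      apply ccont_inv; [apply Cpow_nz, circ_neq_0; lra|]. apply ccont_pow, ccont_circ.
Qed.

(** Cauchy's coefficient integral of f(w) / w^(n+1), in which one power of w has cancelled against
    dw = i w dt. *)
Definition taylor (f : C -> C) (r : R) (n : nat) : C :=
  (/ (2 * PI * Ci) * cint (fun t => f (circ r t) * (Ci / circ r t ^ n)) 0 (2 * PI))%C.

Lemma two_pi_i_neq_0 : (2 * PI * Ci)%C <> 0.
Proof.
  pose proof PI_RGT_0. apply Cmult_neq_0; [|apply Ci_nz].
  apply Cmult_neq_0; intros A; apply RtoC_inj in A; lra.
Qed.

Lemma taylor_bound (f : C -> C) (r R M : R) (n : nat) :
  holo R f -> 0 < r < R -> (forall w, Cmod w = r -> Cmod (f w) <= M) ->
  Cmod (taylor f r n) <= M / r ^ n.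
Proof.
  intros Hf Hr HM. pose proof PI_RGT_0 as HPI.
  unfold taylor. rewrite Cmod_mult, Cmod_inv by apply two_pi_i_neq_0.
  rewrite !Cmod_mult, Cmod_Ci, !Cmod_R, !Rabs_pos_eq by lra.
  apply Rle_trans with (/ (2 * PI * 1) * ((2 * PI - 0) * (M * / r ^ n))).
  - apply Rmult_le_compat_l; [apply Rlt_le, Rinv_0_lt_compat; lra|].
    apply (is_cint_bound (fun t => f (circ r t) * (Ci / circ r t ^ n))%C); [lra| |].
    + intros t _. rewrite Cmod_mult, Cmod_div, Cmod_pow, Cmod_Ci, circ_mod
        by (try lra; apply Cpow_nz, circ_neq_0; lra).
      unfold Rdiv. rewrite Rmult_1_l. apply Rmult_le_compat_r.
      * apply Rlt_le, Rinv_0_lt_compat, pow_lt; lra.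
      * apply HM. apply circ_mod; lra.
    + apply cint_correct; [lra|]. intros t _. apply ccont_mult.
      * destruct (Hf (circ r t)) as [l Hl]; [rewrite circ_mod; lra|].
        apply (ccont_comp f (circ r) t l Hl (ccont_circ r t)).
      * apply ccont_mult; [apply ccont_const|].
        apply ccont_inv; [apply Cpow_nz, circ_neq_0; lra|]. apply ccont_pow, ccont_circ.
  - right. field. split; [apply pow_nonzero; lra|lra].
Qed.

(** The expansion at a point [z] needs a circle that encloses it. Independence of the radius lets a
    single coefficient sequence serve the whole disc. *)
Lemma taylor_radius_lt (f : C -> C) (r r' R : R) (n : nat) :
  holo R f -> 0 < r -> r < r' -> r' < R -> taylor f r n = taylor f r' n.
Proof.
  intros Hf Hr Hrr Hr'. pose proof PI_RGT_0 as HPI. unfold taylor. f_equal.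
  pose proof (homotopy_integral (fun u => f u * / u ^ S n)%C 0 (circ r') (fun t => Ci * circ r' t)%C
     r' (r / r') (2 * PI)) as H.
  assert (Hq : 0 < r / r' < 1).
  { split; [apply Rdiv_lt_0_compat; lra|]. apply Rmult_lt_reg_r with r'; [lra|]. field_simplify; lra. }
  assert (E : forall y, 0 < y <= 1 ->
     cint (fun t => f (0 + RtoC y * circ r' t) * / (0 + RtoC y * circ r' t) ^ S n * (RtoC y * (Ci * circ r' t)))%C 0 (2 * PI)
     = cint (fun t => f (circ (y * r') t) * (Ci / circ (y * r') t ^ n))%C 0 (2 * PI)).
  { intros y Hy. apply (RInt_ext (V := C_R_CompleteNormedModule)). intros t _.
    rewrite circ_scale.
    replace (0 + RtoC y * circ r' t)%C with (RtoC y * circ r' t)%C by ring.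
    assert (A0 : circ r' t <> 0) by (apply circ_neq_0; lra).
    assert (A1 : RtoC y <> 0) by (intros A; apply RtoC_inj in A; lra).
    rewrite Cpow_S.
    assert (((RtoC y * circ r' t) ^ n)%C <> 0) by (apply Cpow_nz, Cmult_neq_0; assumption).
    set (P := ((RtoC y * circ r' t) ^ n)%C) in *.
    change (f (y * circ r' t) * / (y * circ r' t * P) * (y * (Ci * circ r' t))
       = f (y * circ r' t) * (Ci / P))%C.
    field. auto. }
  assert (E1 := E (r / r') ltac:(lra)). assert (E2 := E 1 ltac:(lra)).
  replace (r / r' * r') with r in E1 by (field; lra). rewrite Rmult_1_l in E2.
  rewrite <- E1, <- E2. apply H; auto; try lra.
  - intros t. apply rderiv_circ.
  - intros t. apply ccont_mult; [apply ccont_const|apply ccont_circ].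
  - intros t. rewrite circ_mod; lra.
  - intros t. rewrite Cmod_mult, Cmod_Ci, circ_mod; lra.
  - apply circ_period.
  - intros x t Hx _.
    assert (X : Cmod (0 + x * circ r' t) = x * r').
    { rewrite Cplus_0_l, Cmod_mult, Cmod_R, circ_mod, Rabs_pos_eq; lra. }
    assert (0 < x * r') by (apply Rmult_lt_0_compat; lra).
    destruct (Hf (0 + x * circ r' t)%C) as [l Hl]; [rewrite X; nra|].
    eexists. apply cderiv_mult; [exact Hl|].
    apply (cderiv_inv (fun w => w ^ S n)%C).
    + apply Cpow_nz, Cmod_pos_neq_0. lra.
    + apply (cderiv_pow (fun w => w)), cderiv_id.
Qed.

Lemma taylor_radius (f : C -> C) (r r' R : R) (n : nat) :
  holo R f -> 0 < r < R -> 0 < r' < R -> taylor f r n = taylor f r' n.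
Proof.
  intros Hf Hr Hr'. destruct (Rtotal_order r r') as [H|[H|H]].
  - apply taylor_radius_lt with R; tauto.
  - rewrite H; reflexivity.
  - symmetry. apply taylor_radius_lt with R; tauto.
Qed.

(** * Power series *)

Lemma ccont_bounded (phi : R -> C) (a b : R) :
  a <= b -> (forall t, ccont phi t) -> exists M, forall t, a <= t <= b -> Cmod (phi t) <= M.
Proof.
  intros Hab Hc.
  destruct (continuity_ab_maj (fun t => Cmod (phi t)) a b Hab) as [x [Hx _]].
  - intros t _. intros eps He.
    destruct (proj1 (ccont_spec phi t) (Hc t) eps He) as [d [Hd H]].
    exists d; split; [exact Hd|]. intros s [_ Hs].
    simpl. unfold R_dist. specialize (H s Hs).
    pose proof (Cmod_ge_minus (phi s) (phi t)). pose proof (Cmod_ge_minus (phi t) (phi s)).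
    rewrite (Cmod_minus_sym (phi t) (phi s)) in *. apply Rabs_def1; lra.
  - exists (Cmod (phi x)). exact Hx.
Qed.

Definition psum (R : R) (c : nat -> C) (f : C -> C) : Prop :=
  forall z, Cmod z < R -> cseries (fun n => c n * z ^ n)%C (f z).

Lemma taylor_psum (f : C -> C) (r R : R) :
  holo R f -> 0 < r < R -> psum R (taylor f r) f.
Proof.
  intros Hf Hr z Hz. pose proof (Cmod_ge_0 z) as Z0. pose proof PI_RGT_0 as HPI.
  set (p := (Cmod z + R) / 2). assert (Hp : Cmod z < p < R) by (unfold p; lra).
  assert (Cf : forall t, ccont (fun t => f (circ p t)) t).
  { intros t. destruct (Hf (circ p t)) as [l Hl]; [rewrite circ_mod; lra|].
    apply (ccont_comp f (circ p) t l Hl (ccont_circ p t)). }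
  destruct (ccont_bounded (fun t => f (circ p t)) 0 (2 * PI)) as [M HM]; [lra|exact Cf|].
  pose proof (kernel_expansion (fun t => f (circ p t)) z p M (proj1 Hp) Cf HM) as H.
  cbv beta in H. rewrite (cauchy_kernel f z p R Hf Hp) in H.
  rewrite (kernel_one z p (proj1 Hp)) in H.
  apply (cseries_scal _ _ (/ (2 * PI * Ci))%C) in H.
  replace (/ (2 * PI * Ci) * (f z * (2 * PI * Ci)))%C with (f z) in H.
  - eapply cseries_ext; [|exact H]. intros n. cbv beta.
    rewrite (taylor_radius f r p R n Hf) by lra. unfold taylor. ring.
  - pose proof two_pi_i_neq_0 as N. set (q := (2 * PI * Ci)%C) in *. field. exact N.
Qed.

Lemma finite_bound (b : nat -> C) (N : nat) :
  exists M, forall n, (n < N)%nat -> Cmod (b n) <= M.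
Proof.
  induction N as [|N [M IH]].
  - exists 0. intros n Hn. lia.
  - exists (Rmax M (Cmod (b N))). intros n Hn.
    destruct (Nat.eq_dec n N) as [->|E]; [apply Rmax_r|].
    eapply Rle_trans; [apply IH; lia|apply Rmax_l].
Qed.

Lemma cseries_bounded (a : nat -> C) (l : C) :
  cseries a l -> exists M, 0 <= M /\ forall n, Cmod (a n) <= M.
Proof.
  intros H. destruct (proj1 (cseries_spec a l) H 1 Rlt_0_1) as [N HN].
  destruct (finite_bound (csum a) N) as [M HM].
  assert (B : forall n, Cmod (csum a n) <= Rmax M (Cmod l + 1)).
  { intros n. destruct (le_lt_dec N n) as [L|L].
    - specialize (HN n L). pose proof (Cmod_ge_minus (csum a n) l) as T.
      eapply Rle_trans; [|apply Rmax_r]. lra.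
    - eapply Rle_trans; [apply HM, L|apply Rmax_l]. }
  exists (2 * Rmax M (Cmod l + 1)). pose proof (Cmod_ge_0 l).
  pose proof (Rmax_r M (Cmod l + 1)). split; [lra|].
  intros [|n].
  - rewrite <- (csum_O a). specialize (B 0%nat). lra.
  - replace (a (S n)) with (csum a (S n) - csum a n)%C by (rewrite csum_S; ring).
    unfold Cminus. eapply Rle_trans; [apply Cmod_triangle|]. rewrite Cmod_opp.
    pose proof (B n). pose proof (B (S n)). lra.
Qed.

Lemma cseries_norm_le (a : nat -> C) (b : nat -> R) (l : C) (B : R) :
  cseries a l -> (forall n, Cmod (a n) <= b n) -> is_series b B -> Cmod l <= B.
Proof.
  intros Ha Hab Hb. apply Rnot_lt_le. intros HB.
  set (e := (Cmod l - B) / 2). assert (He : 0 < e) by (unfold e; lra).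
  destruct (proj1 (cseries_spec a l) Ha e He) as [N HN].
  destruct (Hb (ball B e) (locally_ball B (mkposreal e He))) as [N' HN'].
  specialize (HN (max N N') (Nat.le_max_l _ _)). specialize (HN' (max N N') (Nat.le_max_r _ _)).
  assert (S : forall n, Cmod (csum a n) <= sum_n b n).
  { induction n as [|n IH]; [rewrite csum_O, sum_O; apply Hab|].
    rewrite csum_S, sum_Sn. eapply Rle_trans; [apply Cmod_triangle|].
    apply Rplus_le_compat; [exact IH|apply Hab]. }
  specialize (S (max N N')).
  pose proof (Cmod_ge_minus l (csum a (max N N'))) as T. rewrite Cmod_minus_sym in T.
  unfold ball in HN'; simpl in HN'; unfold AbsRing_ball, abs, minus, plus, opp in HN'; simpl in HN'.
  apply Rabs_def2 in HN'.
  pose proof (Rle_lt_trans _ _ _ (Rplus_le_compat_r (- B) _ _ (Rle_trans _ _ _ T S)) (proj1 HN')).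
  unfold e in *. lra.
Qed.

(** Comparison with the geometric series differentiated twice: its coefficients (n + 1)(n + 2)
    dominate n^2, and differentiation preserves the radius of convergence. *)
Lemma ex_series_sqr_geom (x : R) : 0 <= x < 1 -> ex_series (fun n => INR n ^ 2 * x ^ n).
Proof.
  intros Hx.
  assert (CV : Rbar_lt (Rabs x) (CV_radius (PS_derive (PS_derive (fun _ => 1))))).
  { rewrite !CV_radius_derive.
    apply Rbar_lt_le_trans with (Finite ((1 + x) / 2)).
    - simpl. rewrite Rabs_pos_eq; lra.
    - apply (proj1 (CV_radius_bounded (fun _ => 1))). exists 1. intros n.
      rewrite Rmult_1_l, <- RPow_abs, Rabs_pos_eq by lra.
      apply Rle_trans with (1 ^ n); [apply pow_incr; lra|rewrite pow1; lra]. }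
  apply CV_radius_inside in CV.
  apply (ex_series_le (V := R_CompleteNormedModule) _ (fun n => x ^ n * PS_derive (PS_derive (fun _ => 1)) n)).
  - intros n. unfold norm; simpl. unfold abs; simpl.
    rewrite Rabs_pos_eq.
    + rewrite Rmult_comm. apply Rmult_le_compat_l; [apply pow_le; lra|].
      unfold PS_derive. rewrite !S_INR. pose proof (pos_INR n). nra.
    + apply Rmult_le_pos; [|apply pow_le; lra]. pose proof (pos_INR n). nra.
  - eapply ex_series_ext; [|exact CV]. intros n. cbv beta.
    rewrite pow_n_pow. reflexivity.
Qed.

(** The second order error of w^n is carried by induction as w times the previous error plus n
    z^(n-1) (w - z)^2. The factor s^2 stands on the left so that no exponent n - 2 occurs. *)
Lemma pow_diff_quadratic (w z : C) (s : R) (n : nat) :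
  0 < s -> Cmod w <= s -> Cmod z <= s ->
  Cmod (w ^ n - z ^ n - INR n * z ^ pred n * (w - z)) * (s * s) <= INR n ^ 2 * s ^ n * Cmod (w - z) ^ 2.
Proof.
  intros Hs Hw Hz. induction n as [|n IH].
  - simpl. replace (1 - 1 - 0 * 1 * (w - z))%C with (RtoC 0) by ring. rewrite Cmod_0. lra.
  - replace (w ^ S n - z ^ S n - INR (S n) * z ^ pred (S n) * (w - z))%C
      with (w * (w ^ n - z ^ n - INR n * z ^ pred n * (w - z)) + INR n * z ^ pred n * ((w - z) * (w - z)))%C.
    2:{ rewrite S_INR, RtoC_plus, !Cpow_S. destruct n as [|n]; simpl pred; [simpl; ring|].
        rewrite !Cpow_S. ring. }
    set (D := Cmod (w - z)) in *. assert (D0 : 0 <= D) by apply Cmod_ge_0.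
    set (E := Cmod (w ^ n - z ^ n - INR n * z ^ pred n * (w - z))) in *.
    assert (E0 : 0 <= E) by apply Cmod_ge_0.
    assert (N0 : 0 <= INR n) by apply pos_INR.
    assert (S0 : 0 <= s ^ n) by (apply pow_le; lra).
    apply Rle_trans with ((s * E + INR n * Cmod z ^ pred n * (D * D)) * (s * s)).
    { apply Rmult_le_compat_r; [nra|]. eapply Rle_trans; [apply Cmod_triangle|].
      rewrite !Cmod_mult, Cmod_R, Cmod_pow, Rabs_pos_eq by lra. fold D; fold E.
      apply Rplus_le_compat_r. apply Rmult_le_compat_r; lra. }
    assert (Hp : INR n * Cmod z ^ pred n * s <= INR n * s ^ n).
    { destruct n as [|n]; [simpl; lra|]. simpl pred. rewrite Rmult_assoc.
      apply Rmult_le_compat_l; [lra|]. simpl pow. rewrite Rmult_comm.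
      apply Rmult_le_compat_l; [lra|]. apply pow_incr. split; [apply Cmod_ge_0|lra]. }
    rewrite S_INR. simpl pow in *.
    apply Rle_trans with (s * (INR n * (INR n * 1) * s ^ n * (D * (D * 1))) + (INR n * s ^ n) * (D * D * s)).
    + replace ((s * E + INR n * Cmod z ^ pred n * (D * D)) * (s * s))
        with (s * (E * (s * s)) + (INR n * Cmod z ^ pred n * s) * (D * D * s)) by ring.
      apply Rplus_le_compat. apply Rmult_le_compat_l; lra.
      apply Rmult_le_compat_r; [|exact Hp]. apply Rmult_le_pos; nra.
    + assert (Q : 0 <= s * s ^ n * (D * D)) by (apply Rmult_le_pos; nra).
      replace (s * (INR n * (INR n * 1) * s ^ n * (D * (D * 1))) + INR n * s ^ n * (D * D * s))
        with ((INR n * INR n + INR n) * (s * s ^ n * (D * D))) by ring.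
      replace ((INR n + 1) * ((INR n + 1) * 1) * (s * s ^ n) * (D * (D * 1)))
        with ((INR n + 1) * (INR n + 1) * (s * s ^ n * (D * D))) by ring.
      apply Rmult_le_compat_r; [exact Q|]. nra.
Qed.

Lemma cseries_shift (a : nat -> C) (l : C) :
  a 0%nat = RtoC 0 -> cseries a l -> cseries (fun n => a (S n)) l.
Proof.
  intros H0 H. apply cseries_spec. intros eps He.
  destruct (proj1 (cseries_spec a l) H eps He) as [N HN].
  exists N. intros n Hn.
  replace (csum (fun n => a (S n)) n) with (csum a (S n)).
  - apply HN. lia.
  - clear - H0. induction n as [|n IH].
    + rewrite csum_S, !csum_O, H0. ceq. ring.
    + rewrite csum_S, IH, (csum_S (fun n => a (S n))). reflexivity.
Qed.

Lemma psum_coef_bound (c : nat -> C) (f : C -> C) (p R : R) :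
  psum R c f -> 0 <= p < R -> exists M, 0 <= M /\ forall n, Cmod (c n) * p ^ n <= M.
Proof.
  intros H Hp. destruct (cseries_bounded _ _ (H (RtoC p) ltac:(rewrite Cmod_R, Rabs_pos_eq; lra))) as [M [M0 HM]].
  exists M; split; [exact M0|]. intros n. specialize (HM n).
  rewrite Cmod_mult, Cmod_pow, Cmod_R, Rabs_pos_eq in HM by lra. exact HM.
Qed.

(** Termwise differentiation: the error of the n-th term is at most M n^2 (s / p)^n / s^2 times |w -
    z|^2, and these bounds are summable. *)
Lemma psum_cderiv (c : nat -> C) (f : C -> C) (R : R) :
  psum R c f -> forall z, Cmod z < R -> exists l,
    cseries (fun n => INR (S n) * c (S n) * z ^ n)%C l /\ cderiv f z l.
Proof.
  intros Hf z Hz. pose proof (Cmod_ge_0 z) as Z0.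
  (* With |z| < s < p < R, the radius [s] confines [w], while [p] bounds the coefficients. *)
  set (s := (2 * Cmod z + R) / 3). set (p := (Cmod z + 2 * R) / 3).
  assert (Hs : Cmod z < s) by (unfold s; lra). assert (Hp : s < p < R) by (unfold s, p; lra).
  destruct (psum_coef_bound c f p R Hf) as [M [M0 HM]]; [lra|].
  assert (Hx : 0 <= s / p < 1).
  { split; [apply Rdiv_le_0_compat; lra|]. apply Rmult_lt_reg_r with p; [lra|]. field_simplify; lra. }
  destruct (ex_series_sqr_geom (s / p) Hx) as [B HB].
  assert (Hcs : forall n, Cmod (c n) * s ^ n <= M * (s / p) ^ n).
  { intros n. assert (0 < p ^ n) by (apply pow_lt; lra).
    unfold Rdiv. rewrite Rpow_mult_distr, pow_inv.
    apply Rmult_le_reg_r with (p ^ n); [lra|].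
    replace (M * (s ^ n * / p ^ n) * p ^ n) with (M * s ^ n) by (field; lra).
    specialize (HM n). assert (0 <= s ^ n) by (apply pow_le; lra). nra. }
  set (d := fun n => (INR n * c n * z ^ pred n)%C).
  assert (Hd : forall n, Cmod (d n) <= M / s * (INR n ^ 2 * (s / p) ^ n)).
  { intros n. unfold d. rewrite !Cmod_mult, Cmod_R, Cmod_pow, Rabs_pos_eq by apply pos_INR.
    destruct n as [|n].
    - simpl. right. field. lra.
    - apply Rmult_le_reg_r with s; [lra|].
      replace (M / s * (INR (S n) ^ 2 * (s / p) ^ S n) * s) with (INR (S n) * (INR (S n) * (M * (s / p) ^ S n))) by (field; lra).
      replace (INR (S n) * Cmod (c (S n)) * Cmod z ^ pred (S n) * s)
        with (INR (S n) * (Cmod (c (S n)) * (s * Cmod z ^ n))) by (simpl pred; ring).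
      apply Rmult_le_compat_l; [apply pos_INR|].
      apply Rle_trans with (1 * (M * (s / p) ^ S n)).
      + rewrite Rmult_1_l. eapply Rle_trans; [|apply Hcs].
        apply Rmult_le_compat_l; [apply Cmod_ge_0|]. simpl pow.
        apply Rmult_le_compat_l; [lra|]. apply pow_incr. lra.
      + apply Rmult_le_compat_r.
        * apply Rmult_le_pos; [lra|]. apply pow_le; lra.
        * rewrite S_INR. pose proof (pos_INR n). lra. }
  assert (Ed : ex_series (K := C_AbsRing) (V := C_CompleteNormedModule) d).
  { apply (ex_series_le (K := C_AbsRing) (V := C_CompleteNormedModule) d (fun n => M / s * (INR n ^ 2 * (s / p) ^ n)) Hd).
    exists (M / s * B). exact (is_series_scal (V := R_NormedModule) (M / s) _ _ HB). }
  destruct Ed as [l Hl].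
  exists l. split.
  - apply (cseries_shift d l); [unfold d; simpl; ring|exact Hl].
  - apply cderiv_spec. intros eps He.
    set (K := Rabs B * M / (s * s)).
    assert (HK : 0 <= K).
    { unfold K. apply Rdiv_le_0_compat; [|nra]. apply Rmult_le_pos; [apply Rabs_pos|lra]. }
    exists (Rmin (s - Cmod z) (eps / (K + 1))). split.
    { apply Rmin_glb_lt; [lra|]. apply Rdiv_lt_0_compat; lra. }
    intros w Hw.
    assert (W1 := Rlt_le_trans _ _ _ Hw (Rmin_l _ _)).
    assert (W2 := Rlt_le_trans _ _ _ Hw (Rmin_r _ _)).
    assert (Ws : Cmod w <= s).
    { replace w with (w - z + z)%C by ring. eapply Rle_trans; [apply Cmod_triangle|]. lra. }
    pose proof (cseries_minus _ _ _ _ (cseries_minus _ _ _ _ (Hf w ltac:(lra)) (Hf z Hz))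
      (cseries_scal _ _ (w - z)%C Hl)) as HS.
    assert (Q : Cmod (f w - f z - (w - z) * l) <= (M / (s * s) * Cmod (w - z) ^ 2) * B).
    { apply (cseries_norm_le _ (fun n => (M / (s * s) * Cmod (w - z) ^ 2) * (INR n ^ 2 * (s / p) ^ n)) _ _ HS).
      - intros n. cbv beta. unfold d.
        replace (c n * w ^ n - c n * z ^ n - (w - z) * (INR n * c n * z ^ pred n))%C
          with (c n * (w ^ n - z ^ n - INR n * z ^ pred n * (w - z)))%C by ring.
        rewrite Cmod_mult.
        pose proof (pow_diff_quadratic w z s n ltac:(lra) Ws ltac:(lra)) as PD.
        set (E := Cmod (w ^ n - z ^ n - INR n * z ^ pred n * (w - z))) in *.
        apply Rmult_le_reg_r with (s * s); [nra|].
        replace (M / (s * s) * Cmod (w - z) ^ 2 * (INR n ^ 2 * (s / p) ^ n) * (s * s))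
          with ((M * (s / p) ^ n) * (INR n ^ 2 * Cmod (w - z) ^ 2)) by (field; lra).
        apply Rle_trans with (Cmod (c n) * (INR n ^ 2 * s ^ n * Cmod (w - z) ^ 2)).
        + rewrite Rmult_assoc. apply Rmult_le_compat_l; [apply Cmod_ge_0|exact PD].
        + replace (Cmod (c n) * (INR n ^ 2 * s ^ n * Cmod (w - z) ^ 2))
            with (Cmod (c n) * s ^ n * (INR n ^ 2 * Cmod (w - z) ^ 2)) by ring.
          apply Rmult_le_compat_r; [|apply Hcs].
          apply Rmult_le_pos; apply pow2_ge_0.
      - exact (is_series_scal (V := R_NormedModule) (M / (s * s) * Cmod (w - z) ^ 2) _ _ HB). }
    replace (f w - f z - l * (w - z))%C with (f w - f z - (w - z) * l)%C by ring.
    set (D := Cmod (w - z)) in *. assert (D0 : 0 <= D) by apply Cmod_ge_0.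
    apply Rle_trans with (K * D * D).
    + eapply Rle_trans; [exact Q|]. unfold K.
      replace (Rabs B * M / (s * s) * D * D) with (M / (s * s) * D ^ 2 * Rabs B) by (field; lra).
      apply Rmult_le_compat_l; [|apply Rle_abs].
      apply Rmult_le_pos; [apply Rdiv_le_0_compat; nra|apply pow2_ge_0].
    + apply Rmult_le_compat_r; [lra|].
      apply Rle_trans with (K * (eps / (K + 1))); [apply Rmult_le_compat_l; lra|].
      apply Rmult_le_reg_r with (K + 1); [lra|]. field_simplify; [|lra]. nra.
Qed.

Lemma psum_deriv (c : nat -> C) (f f' : C -> C) (R : R) :
  psum R c f -> (forall w, Cmod w < R -> cderiv f w (f' w)) ->
  psum R (fun n => INR (S n) * c (S n))%C f'.
Proof.
  intros H H' z Hz. destruct (psum_cderiv c f R H z Hz) as [l [Hl Hd]].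
  rewrite (cderiv_unique f z (f' z) l (H' z Hz) Hd). exact Hl.
Qed.

Lemma psum_holo (c : nat -> C) (f : C -> C) (R : R) : psum R c f -> holo R f.
Proof. intros H w Hw. destruct (psum_cderiv c f R H w Hw) as [l [_ Hl]]. exists l; exact Hl. Qed.

Lemma holo_psum (f : C -> C) (R : R) : 0 < R -> holo R f -> psum R (taylor f (R / 2)) f.
Proof. intros HR Hf. apply taylor_psum; [exact Hf|lra]. Qed.

Lemma holo_deriv (f f' : C -> C) (R : R) :
  0 < R -> (forall w, Cmod w < R -> cderiv f w (f' w)) -> holo R f'.
Proof.
  intros HR H. eapply psum_holo, psum_deriv; [|exact H].
  apply holo_psum; [exact HR|]. intros w Hw. eexists; apply H, Hw.
Qed.

Lemma cderiv_shift (f : C -> C) (v w l : C) :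
  cderiv f (v + w)%C l -> cderiv (fun u => f (v + u)%C) w l.
Proof.
  intros H. eapply cderiv_eq.
  - apply (cderiv_comp f (fun u => v + u)%C w l 1 H).
    eapply cderiv_eq. apply cderiv_plus; [apply cderiv_const|apply cderiv_id]. ring.
  - ring.
Qed.

Lemma deriv_cderiv (f f' : C -> C) (v : C) (d : R) :
  0 < d -> (forall w, Cmod (w - v) < d -> cderiv f w (f' w)) -> exists l, cderiv f' v l.
Proof.
  intros Hd H.
  assert (A : holo d (fun u => f' (v + u)%C)).
  { apply (holo_deriv (fun u => f (v + u)%C)); [exact Hd|].
    intros w Hw. apply cderiv_shift, H. replace (v + w - v)%C with w by ring. exact Hw. }
  destruct (A 0) as [l Hl]; [rewrite Cmod_0; exact Hd|].
  exists l. pose proof (cderiv_shift (fun u => f' (v + u)%C) (- v) v l) as B.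
  replace (- v + v)%C with (RtoC 0) in B by ring. specialize (B Hl).
  eapply cderiv_ext_loc with (d := 1); [lra| |exact B].
  intros w _. cbv beta. f_equal. ring.
Qed.

Lemma psum_0 (c : nat -> C) (f : C -> C) (R : R) : 0 < R -> psum R c f -> f 0 = c 0%nat.
Proof.
  intros HR H. specialize (H 0). rewrite Cmod_0 in H. specialize (H HR).
  apply (cseries_unique _ _ _ H).
  eapply cseries_ext; [|apply (cseries_single (c 0%nat)); reflexivity].
  intros [|n]; [simpl; ring|]. rewrite Cpow_S. ring.
Qed.

(** By induction [D n] has the coefficients (k + n)! / k! c (k + n), so that its value at 0 is n! c
    n. *)
Lemma psum_chain (D : nat -> C -> C) (c : nat -> C) (R : R) :
  0 < R -> psum R c (D 0%nat) ->
  (forall n w, Cmod w < R -> cderiv (D n) w (D (S n) w)) ->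
  forall n, c n = (D n 0 / INR (fact n))%C.
Proof.
  intros HR H0 HD.
  assert (A : forall n, psum R (fun k => INR (fact (k + n)) / INR (fact k) * c (k + n)%nat)%C (D n)).
  { assert (F : forall k, RtoC (INR (fact k)) <> 0).
    { intros k E. apply RtoC_inj in E. revert E. apply INR_fact_neq_0. }
    induction n as [|n IH].
    - intros z Hz. eapply cseries_ext; [|apply H0, Hz]. intros k. cbv beta.
      rewrite Nat.add_0_r. field. apply F.
    - pose proof (psum_deriv _ _ _ _ IH (HD n)) as B. intros z Hz.
      eapply cseries_ext; [|apply B, Hz]. intros k. cbv beta.
      replace (S k + n)%nat with (k + S n)%nat by lia.
      change (fact (S k)) with (S k * fact k)%nat. rewrite mult_INR, RtoC_mult.
      assert (RtoC (INR (S k)) <> 0).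
      { intros E. apply RtoC_inj in E. revert E. apply not_0_INR. lia. }
      field. split; [apply F|assumption]. }
  intros n. specialize (A n). rewrite (psum_0 _ _ _ HR A). simpl Nat.add.
  assert (RtoC (INR (fact n)) <> 0).
  { intros E. apply RtoC_inj in E. revert E. apply INR_fact_neq_0. }
  simpl (fact 0). simpl (INR 1). field. assumption.
Qed.

(** * Orders of vanishing and the identity theorem *)

(** Cauchy's estimate on a circle of radius e <= 1 bounds the coefficient by eta e^(k-n) <= eta.
    Taking half of its modulus for eta forces it to vanish. *)
Lemma taylor_small_o (f : C -> C) (R r : R) (k n : nat) :
  holo R f -> 0 < r < R ->
  (forall eta, 0 < eta -> exists d, 0 < d /\ forall z, Cmod z < d -> Cmod (f z) <= eta * Cmod z ^ k) ->
  (n <= k)%nat -> taylor f r n = 0.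
Proof.
  intros Hf Hr Ho Hn. destruct (Ceq_dec (taylor f r n) 0) as [E|E]; [exact E|exfalso].
  apply Cmod_gt_0 in E.
  destruct (Ho (Cmod (taylor f r n) / 2)) as [d [Hd H]]; [lra|].
  set (e := Rmin (d / 2) (Rmin (R / 2) 1)).
  assert (e <= d / 2) by apply Rmin_l.
  assert (e <= R / 2) by (eapply Rle_trans; [apply Rmin_r|apply Rmin_l]).
  assert (e <= 1) by (eapply Rle_trans; [apply Rmin_r|apply Rmin_r]).
  assert (0 < e) by (repeat apply Rmin_glb_lt; lra).
  pose proof (taylor_bound f e R (Cmod (taylor f r n) / 2 * e ^ k) n Hf) as B.
  rewrite (taylor_radius f e r R n Hf) in B by lra.
  assert (B' : Cmod (taylor f r n) <= Cmod (taylor f r n) / 2 * e ^ k / e ^ n).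
  { apply B; [lra|]. intros w Hw. rewrite <- Hw. apply H. lra. }
  assert (P : e ^ k / e ^ n <= 1).
  { replace k with (n + (k - n))%nat by lia. rewrite pow_add.
    assert (0 < e ^ n) by (apply pow_lt; lra).
    replace (e ^ n * e ^ (k - n) / e ^ n) with (e ^ (k - n)) by (field; lra).
    rewrite <- (pow1 (k - n)). apply pow_incr. lra. }
  unfold Rdiv in *. rewrite Rmult_assoc in B'. nra.
Qed.

Lemma psum_order (c : nat -> C) (f : C -> C) (R : R) (k : nat) :
  0 < R -> psum R c f -> (forall n, (n < k)%nat -> c n = 0) ->
  exists M r, 0 <= M /\ 0 < r /\ forall z, Cmod z < r -> Cmod (f z) <= M * Cmod z ^ k.
Proof.
  intros HR H H0.
  destruct (psum_coef_bound c f (R / 2) R H) as [M [M0 HM]]; [lra|].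
  set (p := R / 2) in *. assert (Hp : 0 < p) by (unfold p; lra).
  assert (P : forall n, 0 < p ^ n) by (intros n; apply pow_lt; lra).
  (* For |z| < p / 2 the term of index n >= k is at most M / p^k |z|^k (1/2)^(n-k). Writing the last
     factor as 2^k (1/2)^n lets the geometric series be summed from 0, which gives the final factor
     2. *)
  exists (M / p ^ k * 2 ^ k * 2), (p / 2).
  split; [|split; [lra|]].
  { apply Rmult_le_pos; [|lra]. apply Rmult_le_pos; [apply Rdiv_le_0_compat; auto|apply pow_le; lra]. }
  intros z Hz. pose proof (Cmod_ge_0 z) as Z0.
  assert (Hs : is_series (fun n => M / p ^ k * 2 ^ k * Cmod z ^ k * (/ 2) ^ n) (M / p ^ k * 2 ^ k * Cmod z ^ k * (/ (1 - / 2)))).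
  { apply (is_series_scal (V := R_NormedModule)). apply is_series_geom. rewrite Rabs_pos_eq; lra. }
  replace (M / p ^ k * 2 ^ k * 2 * Cmod z ^ k) with (M / p ^ k * 2 ^ k * Cmod z ^ k * (/ (1 - / 2))).
  2:{ field. specialize (P k). lra. }
  eapply cseries_norm_le; [apply H; unfold p in Hz; lra| |exact Hs].
  intros n. cbv beta.
  assert (Q : 0 <= M / p ^ k * 2 ^ k * Cmod z ^ k).
  { apply Rmult_le_pos; [|apply pow_le; lra]. apply Rmult_le_pos; [apply Rdiv_le_0_compat; auto|apply pow_le; lra]. }
  destruct (le_lt_dec k n) as [L|L].
  2:{ rewrite (H0 n L), Cmult_0_l, Cmod_0. apply Rmult_le_pos; [exact Q|apply pow_le; lra]. }
  rewrite Cmod_mult, Cmod_pow.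
  replace n with (k + (n - k))%nat by lia. set (j := (n - k)%nat).
  specialize (HM (k + j)%nat). rewrite !pow_add in *.
  replace (M / p ^ k * 2 ^ k * Cmod z ^ k * ((/ 2) ^ k * (/ 2) ^ j))
    with (M / (p ^ k * p ^ j) * (Cmod z ^ k * (p * / 2) ^ j)).
  2:{ rewrite Rpow_mult_distr, !pow_inv. field. 
      pose proof (P k); pose proof (P j). assert (0 < 2 ^ k) by (apply pow_lt; lra).
      assert (0 < 2 ^ j) by (apply pow_lt; lra). repeat split; lra. }
  apply Rmult_le_compat.
  - apply Cmod_ge_0.
  - apply Rmult_le_pos; apply pow_le; lra.
  - apply Rmult_le_reg_r with (p ^ k * p ^ j); [apply Rmult_lt_0_compat; auto|].
    pose proof (P k); pose proof (P j).
    replace (M / (p ^ k * p ^ j) * (p ^ k * p ^ j)) with M by (field; lra). exact HM.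
  - apply Rmult_le_compat_l; [apply pow_le; lra|]. apply pow_incr. lra.
Qed.

(** A holomorphic function vanishes to an integral order: a bound o(z^k) kills all coefficients up
    to k and so improves to O(z^(k+1)). *)
Lemma holo_small_o (f : C -> C) (R : R) (k : nat) :
  0 < R -> holo R f ->
  (forall eta, 0 < eta -> exists d, 0 < d /\ forall z, Cmod z < d -> Cmod (f z) <= eta * Cmod z ^ k) ->
  exists M r, 0 <= M /\ 0 < r /\ forall z, Cmod z < r -> Cmod (f z) <= M * Cmod z ^ S k.
Proof.
  intros HR Hf Ho. apply (psum_order (taylor f (R / 2)) f R); [exact HR|apply holo_psum; assumption|].
  intros n Hn. apply (taylor_small_o f R (R / 2) k n Hf); [lra|exact Ho|lia].
Qed.

(** The bound is a statement about vanishing Taylor coefficients, and differentiation shifts these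
    by one place. *)
Lemma holo_order_deriv (f f' : C -> C) (R M r : R) (k : nat) :
  0 < R -> (forall w, Cmod w < R -> cderiv f w (f' w)) -> 0 < r ->
  (forall z, Cmod z < r -> Cmod (f z) <= M * Cmod z ^ S k) ->
  exists M r, 0 <= M /\ 0 < r /\ forall z, Cmod z < r -> Cmod (f' z) <= M * Cmod z ^ k.
Proof.
  intros HR Hf Hr HM.
  assert (Hh : holo R f) by (intros w Hw; eexists; apply Hf, Hw).
  eapply psum_order; [exact HR|eapply psum_deriv; [apply holo_psum; eassumption|exact Hf]|].
  intros n Hn. cbv beta. rewrite (taylor_small_o f R (R / 2) k (S n) Hh); [ring|lra| |lia].
  intros eta He. set (Ma := Rabs M + 1). assert (HMa : 0 < Ma) by (unfold Ma; pose proof (Rabs_pos M); lra).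
  exists (Rmin r (eta / Ma)). split; [apply Rmin_glb_lt; [lra|apply Rdiv_lt_0_compat; lra]|].
  intros z Hz. pose proof (Cmod_ge_0 z) as Z0.
  eapply Rle_trans; [apply HM; eapply Rlt_le_trans; [exact Hz|apply Rmin_l]|].
  assert (Z1 := Rlt_le_trans _ _ _ Hz (Rmin_r _ _)).
  simpl pow. rewrite <- Rmult_assoc. apply Rmult_le_compat_r; [apply pow_le; lra|].
  apply Rle_trans with (Ma * Cmod z).
  - apply Rmult_le_compat_r; [lra|]. unfold Ma. pose proof (Rle_abs M). lra.
  - apply Rmult_lt_compat_l with (r := Ma) in Z1; [|lra].
    replace (Ma * (eta / Ma)) with eta in Z1 by (field; lra). lra.
Qed.

(** The coefficients computed on the circle of radius r / 2 vanish, and the same coefficients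
    represent [f] on every larger disc. *)
Lemma entire_zero (f : C -> C) (r : R) :
  (forall w, exists l, cderiv f w l) -> 0 < r ->
  (forall z, 0 < Cmod z < r -> f z = 0) -> forall z, f z = 0.
Proof.
  intros Hf Hr H z. pose proof (Cmod_ge_0 z) as Z0.
  set (R := Cmod z + r). assert (HR : holo R f) by (intros w _; apply Hf).
  pose proof (taylor_psum f (r / 2) R HR ltac:(unfold R; lra) z ltac:(unfold R; lra)) as S.
  apply (cseries_unique _ _ _ S).
  eapply cseries_ext; [|apply (cseries_single 0); reflexivity].
  intros n. replace (taylor f (r / 2) n) with (RtoC 0); [destruct n; ring|].
  symmetry. apply Cmod_eq_0. apply Rle_antisym; [|apply Cmod_ge_0].
  eapply Rle_trans; [apply (taylor_bound f (r / 2) R 0 n HR)|]; [unfold R; lra| |unfold Rdiv; lra].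
  intros w Hw. rewrite H by lra. rewrite Cmod_0. lra.
Qed.

Lemma holo_first_order (f : C -> C) (l : C) (R : R) :
  0 < R -> holo R f -> cderiv f 0 l ->
  exists M r, 0 <= M /\ 0 < r /\ forall z, Cmod z < r -> Cmod (f z - f 0 - l * z) <= M * Cmod z ^ 2.
Proof.
  intros HR Hf Hl.
  apply (holo_small_o (fun z => f z - f 0 - l * z)%C R 1 HR).
  - intros w Hw. destruct (Hf w Hw) as [m Hm]. eexists.
    apply cderiv_minus; [apply cderiv_minus; [exact Hm|apply cderiv_const]|].
    apply cderiv_mult; [apply cderiv_const|apply cderiv_id].
  - intros eta He. destruct (proj1 (cderiv_spec _ _ _) Hl eta He) as [d [Hd H]].
    exists d; split; [exact Hd|]. intros z Hz. specialize (H z).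
    replace (z - 0)%C with z in H by ring. rewrite pow_1. apply H, Hz.
Qed.

(** * The complex exponential *)

Lemma Cmod_le_abs (a b : R) : Cmod (a, b) <= Rabs a + Rabs b.
Proof.
  replace ((a, b) : C) with (RtoC a + Ci * RtoC b)%C.
  - eapply Rle_trans; [apply Cmod_triangle|]. rewrite Cmod_mult, Cmod_Ci, !Cmod_R. lra.
  - unfold RtoC, Ci, Cplus, Cmult; simpl. f_equal; ring.
Qed.

Lemma derivable_pt_lim_0_spec (f : R -> R) (l : R) :
  derivable_pt_lim f 0 l -> forall eps, 0 < eps -> exists d, 0 < d /\
    forall h, Rabs h < d -> Rabs (f h - f 0 - l * h) <= eps * Rabs h.
Proof.
  intros H eps He. destruct (H eps He) as [d Hd]. exists d; split; [apply cond_pos|].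
  intros h Hh. destruct (Req_dec h 0) as [->|N].
  - replace (f 0 - f 0 - l * 0) with 0 by ring. rewrite Rabs_R0. lra.
  - specialize (Hd h N Hh). rewrite Rplus_0_l in Hd.
    replace (f h - f 0 - l * h) with (((f h - f 0) / h - l) * h) by (field; exact N).
    rewrite Rabs_mult. apply Rmult_le_compat_r; [apply Rabs_pos|lra].
Qed.

Lemma Cexp_plus (z w : C) : Cexp (z + w) = (Cexp z * Cexp w)%C.
Proof.
  destruct z as [a b], w as [c d]. unfold Cexp, Cmult, Cplus, Re, Im; simpl.
  rewrite exp_plus, cos_plus, sin_plus. f_equal; ring.
Qed.

Lemma Cexp_0 : Cexp 0 = 1.
Proof. unfold Cexp, RtoC, Re, Im; simpl. rewrite exp_0, cos_0, sin_0. f_equal; ring. Qed.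

Lemma Cexp_neq_0 (z : C) : Cexp z <> 0.
Proof.
  intros E. pose proof (Cexp_plus z (- z)) as H.
  rewrite E, Cplus_opp_r, Cexp_0, Cmult_0_l in H. exact (C1_nz H).
Qed.

Lemma cderiv_Cexp_0 : cderiv Cexp 0 1.
Proof.
  apply cderiv_spec. intros eps He.
  (* The errors below add up to at most 8 e |w|, so eps / 20 suffices. The conditions |w| <= e <= 1
     bound exp a by 3 and make the quadratic terms linear in |w|. *)
  set (e := Rmin (eps / 20) 1).
  assert (He1 : 0 < e) by (apply Rmin_glb_lt; lra).
  assert (He2 : e <= 1) by apply Rmin_r. assert (He3 : e <= eps / 20) by apply Rmin_l.
  destruct (derivable_pt_lim_0_spec exp 1 derivable_pt_lim_exp_0 e He1) as [d1 [Hd1 H1]].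
  destruct (derivable_pt_lim_0_spec sin 1 derivable_pt_lim_sin_0 e He1) as [d2 [Hd2 H2]].
  destruct (derivable_pt_lim_0_spec cos 0 derivable_pt_lim_cos_0 e He1) as [d3 [Hd3 H3]].
  exists (Rmin (Rmin d1 d2) (Rmin d3 e)). split; [repeat apply Rmin_glb_lt; lra|].
  intros w Hw. replace (w - 0)%C with w in * by ring. rewrite Cexp_0.
  assert (W := Rle_trans _ _ _ (Rmin_l _ _) (Rmin_l _ _) : Rmin (Rmin d1 d2) (Rmin d3 e) <= d1).
  assert (W2 := Rle_trans _ _ _ (Rmin_l _ _) (Rmin_r _ _) : Rmin (Rmin d1 d2) (Rmin d3 e) <= d2).
  assert (W3 := Rle_trans _ _ _ (Rmin_r _ _) (Rmin_l _ _) : Rmin (Rmin d1 d2) (Rmin d3 e) <= d3).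
  assert (W4 := Rle_trans _ _ _ (Rmin_r _ _) (Rmin_r _ _) : Rmin (Rmin d1 d2) (Rmin d3 e) <= e).
  destruct w as [a b]. pose proof (Rmax_Cmod (a, b)) as Hm. simpl fst in Hm; simpl snd in Hm.
  set (m := Cmod (a, b)) in *.
  assert (Ha : Rabs a <= m) by (eapply Rle_trans; [apply Rmax_l|exact Hm]).
  assert (Hb : Rabs b <= m) by (eapply Rle_trans; [apply Rmax_r|exact Hm]).
  specialize (H1 a ltac:(lra)). specialize (H2 b ltac:(lra)). specialize (H3 b ltac:(lra)).
  rewrite exp_0 in H1. rewrite sin_0 in H2. rewrite cos_0 in H3.
  replace (Cexp (a, b) - 1 - 1 * (a, b))%C
    with (((exp a - 1 - 1 * a) * cos b + (1 + a) * (cos b - 1 - 0 * b),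
           exp a * (sin b - 0 - 1 * b) + b * ((exp a - 1 - 1 * a) + a))%R).
  2:{ unfold Cexp, Cminus, Cmult, Cplus, Copp, RtoC, Re, Im; simpl. f_equal; ring. }
  eapply Rle_trans; [apply Cmod_le_abs|].
  set (E := exp a - 1 - 1 * a) in *. set (S := sin b - 0 - 1 * b) in *. set (K := cos b - 1 - 0 * b) in *.
  assert (Em : Rabs E <= e * m) by (eapply Rle_trans; [exact H1|]; apply Rmult_le_compat_l; lra).
  assert (Sm : Rabs S <= e * m) by (eapply Rle_trans; [exact H2|]; apply Rmult_le_compat_l; lra).
  assert (Km : Rabs K <= e * m) by (eapply Rle_trans; [exact H3|]; apply Rmult_le_compat_l; lra).
  assert (m0 : 0 <= m) by apply Cmod_ge_0.
  assert (me : m <= e) by lra.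
  assert (Cb : Rabs (cos b) <= 1) by (apply Rabs_le; apply COS_bound).
  assert (A1 : Rabs (1 + a) <= 2).
  { eapply Rle_trans; [apply Rabs_triang|]. rewrite Rabs_R1. lra. }
  assert (Ex : Rabs (exp a) <= 3).
  { replace (exp a) with (E + (1 + a)) by (unfold E; ring).
    eapply Rle_trans; [apply Rabs_triang|]. nra. }
  assert (T1 : Rabs (E * cos b + (1 + a) * K) <= e * m * 1 + 2 * (e * m)).
  { eapply Rle_trans; [apply Rabs_triang|]. rewrite !Rabs_mult.
    apply Rplus_le_compat; apply Rmult_le_compat; auto using Rabs_pos. }
  assert (T2 : Rabs (exp a * S + b * (E + a)) <= 3 * (e * m) + m * (e * m + m)).
  { eapply Rle_trans; [apply Rabs_triang|]. rewrite !Rabs_mult.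
    apply Rplus_le_compat; apply Rmult_le_compat; auto using Rabs_pos.
    eapply Rle_trans; [apply Rabs_triang|]. lra. }
  assert (m * (e * m + m) <= 2 * (e * m)) by nra.
  apply Rle_trans with (8 * (e * m)); [lra|].
  replace (8 * (e * m)) with ((8 * e) * m) by ring. apply Rmult_le_compat_r; lra.
Qed.

Lemma cderiv_Cexp (z : C) : cderiv Cexp z (Cexp z).
Proof.
  apply cderiv_ext_loc with (f := (fun w => Cexp z * Cexp (- z + w))%C) (d := 1); [lra| |].
  - intros w _. rewrite <- Cexp_plus. f_equal. ring.
  - eapply cderiv_eq. apply cderiv_mult; [apply cderiv_const|].
    apply cderiv_shift. replace (- z + z)%C with (RtoC 0) by ring. apply cderiv_Cexp_0.
    cbv beta. ring.
Qed.

(** * The polynomials [P_k] *)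

(* Monomials [c X^i Y^j Z^k W^l], to be evaluated at [X = wp(v - u)],
   [Y = wp'(v - u)], [Z = g2 / 2], [W = wp(v)]. *)
Definition zpoly4 := list (Z * (nat * nat * nat * nat)).

Definition mono4_eval (m : Z * (nat * nat * nat * nat)) (x y z w : C) : C :=
  let '(c, (i, j, k, l)) := m in (IZR c * (x ^ i * (y ^ j * (z ^ k * w ^ l))))%C.

Definition zpoly4_eval (p : zpoly4) (x y z w : C) : C :=
  fold_right (fun m acc => mono4_eval m x y z w + acc)%C (RtoC 0) p.

(* The derivation with [X' = Y], [Y' = 6 X^2 - Z], [Z' = W' = 0]. *)
Definition mono4_der (m : Z * (nat * nat * nat * nat)) : zpoly4 :=
  let '(c, (i, j, k, l)) := m in
  ((c * Z.of_nat i)%Z, (pred i, S j, k, l)) ::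
  ((6 * c * Z.of_nat j)%Z, (S (S i), pred j, k, l)) ::
  ((- c * Z.of_nat j)%Z, (i, pred j, S k, l)) :: nil.

Definition zpoly4_der (p : zpoly4) : zpoly4 := flat_map mono4_der p.

Definition zpoly4_opp (p : zpoly4) : zpoly4 :=
  map (fun '(c, e) => (- c, e)%Z) p.

(* [2 X + W] is the potential of the linear equation satisfied by [1 / Phi]. *)
Definition zpoly4_pot (p : zpoly4) : zpoly4 :=
  flat_map (fun '(c, (i, j, k, l)) => ((2 * c)%Z, (S i, j, k, l)) :: (c, (i, j, k, S l)) :: nil) p.

(* At [u = 0] the variables [X] and [W] take the same value. *)
Definition zpoly4_diag (p : zpoly4) : zpoly3 :=
  map (fun '(c, (i, j, k, l)) => (c, (i + l, j, k)%nat)) p.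

Lemma zpoly4_eval_app (p q : zpoly4) (x y z w : C) :
  zpoly4_eval (p ++ q) x y z w = (zpoly4_eval p x y z w + zpoly4_eval q x y z w)%C.
Proof. induction p as [|m p IH]; simpl; [ring|rewrite IH; ring]. Qed.

Lemma zpoly4_eval_opp (p : zpoly4) (x y z w : C) :
  zpoly4_eval (zpoly4_opp p) x y z w = (- zpoly4_eval p x y z w)%C.
Proof.
  induction p as [|[c [[[i j] k] l]] p IH]; simpl; [ring|].
  rewrite IH, opp_IZR, RtoC_opp. ring.
Qed.

Lemma zpoly4_eval_pot (p : zpoly4) (x y z w : C) :
  zpoly4_eval (zpoly4_pot p) x y z w = ((2 * x + w) * zpoly4_eval p x y z w)%C.
Proof.
  induction p as [|[c [[[i j] k] l]] p IH]; [simpl; ring|].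
  unfold zpoly4_pot in *. cbn [flat_map app]. cbn [zpoly4_eval fold_right].
  fold (zpoly4_eval (flat_map (fun '(c, (i, j, k, l)) => ((2 * c)%Z, (S i, j, k, l)) :: (c, (i, j, k, S l)) :: nil) p) x y z w).
  fold (zpoly4_eval p x y z w).
  rewrite IH. unfold mono4_eval. rewrite mult_IZR, RtoC_mult, !Cpow_S. ring.
Qed.

Lemma zpoly4_eval_diag (p : zpoly4) (x y z : C) :
  zpoly3_eval (zpoly4_diag p) x y z = zpoly4_eval p x y z x.
Proof.
  induction p as [|[c [[[i j] k] l]] p IH]; simpl; [reflexivity|].
  rewrite IH, Cpow_add_r. ring.
Qed.

(** The factor [s] is an inner derivative; it is -1 for functions of v - u. *)
Lemma zpoly4_eval_cderiv (p : zpoly4) (X Y : C -> C) (z w s u : C) :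
  cderiv X u (s * Y u)%C -> cderiv Y u (s * (6 * X u ^ 2 - z))%C ->
  cderiv (fun t => zpoly4_eval p (X t) (Y t) z w) u (s * zpoly4_eval (zpoly4_der p) (X u) (Y u) z w)%C.
Proof.
  intros HX HY. induction p as [|[c [[[i j] k] l]] p IH].
  - eapply cderiv_eq; [exact (cderiv_const (RtoC 0) u)|]. simpl. ring.
  - unfold zpoly4_der in *. cbn [flat_map]. rewrite zpoly4_eval_app.
    eapply cderiv_eq.
    + apply (cderiv_plus (fun t => mono4_eval (c, (i, j, k, l)) (X t) (Y t) z w)); [|exact IH].
      apply (cderiv_mult (fun _ => RtoC (IZR c)) (fun t => X t ^ i * (Y t ^ j * (z ^ k * w ^ l)))%C);
        [apply cderiv_const|].
      apply (cderiv_mult (fun t => X t ^ i)%C (fun t => Y t ^ j * (z ^ k * w ^ l))%C); [apply cderiv_pow, HX|].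
      apply (cderiv_mult (fun t => Y t ^ j)%C (fun t => z ^ k * w ^ l)%C); [apply cderiv_pow, HY|].
      apply cderiv_const.
    + cbv beta. cbn [mono4_der zpoly4_eval fold_right mono4_eval].
      rewrite !mult_IZR, !opp_IZR, <- !INR_IZR_INZ, !RtoC_mult, !RtoC_opp, !Cpow_S.
      change (Cpow (X u) 0) with (RtoC 1). ring.
Qed.

(** The recursion is (a f + b f')' = (a' + (2 X + W) b) f + (a + b') f'. The formal derivation
    enters with a minus sign because X and Y are functions of v - u. *)
Fixpoint BA_polys (n : nat) : zpoly4 * zpoly4 :=
  match n with
  | O => ((1%Z, (0, 0, 0, 0)%nat) :: nil, nil)
  | S n => let (a, b) := BA_polys n in
      (zpoly4_opp (zpoly4_der a) ++ zpoly4_pot b, a ++ zpoly4_opp (zpoly4_der b))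
  end.

(* With the derivation above, [f'' = (2 X + W) f] makes the [n]-th derivative of
   [f] equal to [a f + b f'] for [(a, b) = BA_polys n]. *)
Lemma BA_polys_cderiv (f f1 X Y : C -> C) (z w u : C) (n : nat) :
  cderiv f u (f1 u) -> cderiv f1 u ((2 * X u + w) * f u)%C ->
  cderiv X u (- Y u)%C -> cderiv Y u (- (6 * X u ^ 2 - z))%C ->
  let D n t := (zpoly4_eval (fst (BA_polys n)) (X t) (Y t) z w * f t
    + zpoly4_eval (snd (BA_polys n)) (X t) (Y t) z w * f1 t)%C in
  cderiv (D n) u (D (S n) u).
Proof.
  intros Hf Hf1 HX HY D. unfold D. simpl BA_polys. destruct (BA_polys n) as [a b]. simpl fst; simpl snd.
  assert (HX' : cderiv X u (- (1) * Y u)%C) by (eapply cderiv_eq; [exact HX|ring]).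
  assert (HY' : cderiv Y u (- (1) * (6 * X u ^ 2 - z))%C) by (eapply cderiv_eq; [exact HY|ring]).
  eapply cderiv_eq.
  - apply cderiv_plus; apply cderiv_mult;
      [apply zpoly4_eval_cderiv; eassumption|exact Hf|apply zpoly4_eval_cderiv; eassumption|exact Hf1].
  - cbv beta. rewrite !zpoly4_eval_app, !zpoly4_eval_opp, zpoly4_eval_pot. ring.
Qed.

(** * Weierstrass functions *)

Ltac cderiv_rules :=
  lazymatch goal with
  | |- cderiv (fun _ => ?a) _ _ => apply (cderiv_const a)
  | |- cderiv (fun w => w) _ _ => apply cderiv_id
  | |- cderiv (fun w => Cplus (@?f w) (@?g w)) _ _ => apply (cderiv_plus f g); cderiv_rules
  | |- cderiv (fun w => Cminus (@?f w) (@?g w)) _ _ => apply (cderiv_minus f g); cderiv_rules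
  | |- cderiv (fun w => Copp (@?f w)) _ _ => apply (cderiv_opp f); cderiv_rules
  | |- cderiv (fun w => Cmult (@?f w) (@?g w)) _ _ => apply (cderiv_mult f g); cderiv_rules
  | |- _ => eassumption
  end.

Record weierstrass (g2 g3 : C) (sigma zeta wp dwp : C -> C) : Prop := {
  sigma_entire : forall z, exists l, cderiv sigma z l;
  sigma_0 : exists M r, 0 < r /\
    forall z, Cmod z < r -> Cmod (sigma z - z) <= M * Cmod z ^ 5;
  sigma_cderiv : forall z, sigma z <> 0 -> cderiv sigma z (zeta z * sigma z)%C;
  zeta_cderiv : forall z, sigma z <> 0 -> cderiv zeta z (- wp z)%C;
  wp_cderiv : forall z, sigma z <> 0 -> cderiv wp z (dwp z);
  wp_cubic : forall z, sigma z <> 0 ->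
    (dwp z ^ 2 = 4 * wp z ^ 3 - g2 * wp z - g3)%C }.

Lemma cderiv_nonzero_open (f : C -> C) (v l : C) :
  cderiv f v l -> f v <> 0 -> exists d, 0 < d /\ forall w, Cmod (w - v) < d -> f w <> 0.
Proof.
  intros Hf H0. apply Cmod_gt_0 in H0.
  destruct (cderiv_continuous_spec f v l Hf (Cmod (f v)) H0) as [d [Hd H]].
  exists d; split; [exact Hd|]. intros w Hw E. specialize (H w Hw). rewrite E in H.
  replace (0 - f v)%C with (- f v)%C in H by ring. rewrite Cmod_opp in H. lra.
Qed.

Lemma cderiv_C_derive (f : C -> C) (z : C) :
  (exists l, cderiv f z l) -> cderiv f z (C_derive f z).
Proof.
  intros [l Hl]. apply cderiv_normed. apply C_derive_correct; [exact z|].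
  exists l. apply cderiv_normed. exact Hl.
Qed.

Lemma entire_deriv (f : C -> C) :
  (forall z, exists l, cderiv f z l) ->
  exists f', (forall z, cderiv f z (f' z)) /\ forall z, exists l, cderiv f' z l.
Proof.
  intros H. assert (D : forall z, cderiv f z (C_derive f z)).
  { intros z. apply cderiv_C_derive, H. }
  exists (C_derive f). split; [exact D|].
  intros z. apply (deriv_cderiv f (C_derive f) z 1); [lra|]. intros w _. apply D.
Qed.

Lemma cderiv_eq_at (f g : C -> C) (z l m : C) (d : R) :
  0 < d -> cderiv f z l -> cderiv g z m ->
  (forall w, 0 < Cmod (w - z) < d -> f w = g w) -> f z = g z.
Proof.
  intros Hd Hf Hg H. apply Ceq_minus.
  destruct (Ceq_dec (f z - g z) 0) as [E|E]; [exact E|exfalso].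
  destruct (cderiv_nonzero_open (fun w => f w - g w)%C z _ (cderiv_minus _ _ _ _ _ Hf Hg) E)
    as [d' [Hd' H']].
  set (e := Rmin d d' / 2).
  assert (He : 0 < e) by (unfold e; pose proof (Rmin_glb_lt d d' 0 Hd Hd'); lra).
  assert (Cmod (z + e - z) = e).
  { replace (z + e - z)%C with (RtoC e) by ring. rewrite Cmod_R, Rabs_pos_eq; lra. }
  apply (H' (z + e)%C).
  - rewrite H0. unfold e in *. pose proof (Rmin_r d d'). lra.
  - rewrite H; [ring|]. rewrite H0. unfold e in *. pose proof (Rmin_l d d'). lra.
Qed.

Lemma sigma_near_0 (g2 g3 : C) (sigma zeta wp dwp s1 s2 : C -> C) :
  weierstrass g2 g3 sigma zeta wp dwp ->
  (forall z, cderiv sigma z (s1 z)) -> (forall z, cderiv s1 z (s2 z)) ->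
  exists K r, 0 <= K /\ 0 < r <= 1 /\ forall u, Cmod u < r ->
    Cmod (sigma u - u) <= K * Cmod u ^ 5 /\ Cmod (s1 u - 1) <= K * Cmod u ^ 4 /\
    Cmod (s2 u) <= K * Cmod u ^ 3 /\ Cmod u / 2 <= Cmod (sigma u).
Proof.
  intros W D0' D1'. destruct (sigma_0 _ _ _ _ _ _ W) as (M & r & Hr & HM).
  assert (D0 : forall w, cderiv (fun u => sigma u - u)%C w (s1 w - 1)%C).
  { intros w. pose proof (D0' w). cderiv_rules. }
  assert (D1 : forall w, cderiv (fun u => s1 u - 1)%C w (s2 w)).
  { intros w. pose proof (D1' w).
    eapply cderiv_eq; [cderiv_rules|]. ring. }
  destruct (holo_order_deriv _ _ 1 M r 4 Rlt_0_1 (fun w _ => D0 w) Hr HM) as (M1 & r1 & M10 & Hr1 & HM1).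
  destruct (holo_order_deriv _ _ 1 M1 r1 3 Rlt_0_1 (fun w _ => D1 w) Hr1 HM1) as (M2 & r2 & M20 & Hr2 & HM2).
  set (K := Rabs M + M1 + M2). pose proof (Rabs_pos M) as A. pose proof (Rle_abs M) as A'.
  assert (K0 : 0 <= K) by (unfold K; lra).
  (* Together with |u| <= 1 this bound on |u| makes K |u|^5 at most |u| / 2, which yields the lower
     bound for sigma and isolates its zero at 0. *)
  set (q := / (2 * (K + 1))). assert (Hq : 0 < q) by (unfold q; apply Rinv_0_lt_compat; lra).
  exists K, (Rmin (Rmin r 1) (Rmin (Rmin r1 r2) q)).
  pose proof (Rmin_l (Rmin r 1) (Rmin (Rmin r1 r2) q)). pose proof (Rmin_r (Rmin r 1) (Rmin (Rmin r1 r2) q)).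
  pose proof (Rmin_l r 1). pose proof (Rmin_r r 1).
  pose proof (Rmin_l (Rmin r1 r2) q). pose proof (Rmin_r (Rmin r1 r2) q).
  pose proof (Rmin_l r1 r2). pose proof (Rmin_r r1 r2).
  split; [exact K0|]. split; [split; [repeat apply Rmin_glb_lt; lra|lra]|].
  intros u Hu. pose proof (Cmod_ge_0 u) as U0.
  assert (P : forall n, 0 <= Cmod u ^ n) by (intros n; apply pow_le, U0).
  assert (B0 : Cmod (sigma u - u) <= K * Cmod u ^ 5).
  { eapply Rle_trans; [apply HM; lra|]. apply Rmult_le_compat_r; [apply P|unfold K; lra]. }
  split; [exact B0|]. split.
  { eapply Rle_trans; [apply HM1; lra|]. apply Rmult_le_compat_r; [apply P|unfold K; lra]. }
  split.
  { eapply Rle_trans; [apply HM2; lra|]. apply Rmult_le_compat_r; [apply P|unfold K; lra]. }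
  pose proof (Cmod_ge_minus u (sigma u)) as T. rewrite Cmod_minus_sym in T.
  assert (Q : (K + 1) * Cmod u <= / 2).
  { apply Rle_trans with ((K + 1) * q); [apply Rmult_le_compat_l; lra|]. unfold q. right; field. lra. }
  assert (U3 : Cmod u ^ 3 <= 1).
  { rewrite <- (pow1 3). apply pow_incr. lra. }
  assert (K * Cmod u ^ 5 <= Cmod u / 2); [|lra].
  replace (K * Cmod u ^ 5) with (K * Cmod u * Cmod u ^ 3 * Cmod u) by ring.
  replace (Cmod u / 2) with (/ 2 * 1 * Cmod u) by field.
  apply Rmult_le_compat_r; [exact U0|]. apply Rmult_le_compat; auto; [|nra].
  apply Rmult_le_pos; lra.
Qed.

Lemma zeta_sigma (g2 g3 : C) (sigma zeta wp dwp s1 : C -> C) :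
  weierstrass g2 g3 sigma zeta wp dwp -> (forall z, cderiv sigma z (s1 z)) ->
  forall z, sigma z <> 0 -> (zeta z * sigma z = s1 z)%C.
Proof.
  intros W D0 z Hz.
  apply (cderiv_unique sigma z); [apply (sigma_cderiv _ _ _ _ _ _ W), Hz|apply D0].
Qed.

(** Clearing the denominator of wp = - (sigma' / sigma)' leaves an entire right-hand side, which can
    be handled across the zeros of sigma. *)
Lemma wp_sigma (g2 g3 : C) (sigma zeta wp dwp s1 s2 : C -> C) :
  weierstrass g2 g3 sigma zeta wp dwp ->
  (forall z, cderiv sigma z (s1 z)) -> (forall z, cderiv s1 z (s2 z)) ->
  forall z, sigma z <> 0 -> (wp z * sigma z ^ 2 = s1 z ^ 2 - sigma z * s2 z)%C.
Proof.
  intros W D0 D1 z Hz. pose proof (zeta_sigma _ _ _ _ _ _ _ W D0) as Z1.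
  destruct (cderiv_nonzero_open sigma z (s1 z) (D0 z) Hz) as [d [Hd H]].
  pose proof (zeta_cderiv _ _ _ _ _ _ W z Hz) as Dz. pose proof (D0 z) as D0z.
  assert (T : cderiv s1 z (- wp z * sigma z + zeta z * s1 z)%C).
  { apply (cderiv_ext_loc (fun w => zeta w * sigma w)%C s1 z _ d Hd).
    - intros w Hw. apply Z1, H, Hw.
    - cderiv_rules. }
  pose proof (cderiv_unique _ _ _ _ T (D1 z)) as U.
  rewrite <- U, <- (Z1 z Hz). ring.
Qed.

(** Differentiating the cubic yields the claim only after multiplication by wp', which may vanish.
    The detour through an entire function avoids any discussion of whether the complement of the
    zeros of sigma and wp' is connected. *)
Lemma wp_second_derivative (g2 g3 : C) (sigma zeta wp dwp : C -> C) :
  weierstrass g2 g3 sigma zeta wp dwp ->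
  forall z, sigma z <> 0 -> cderiv dwp z (6 * wp z ^ 2 - g2 / 2)%C.
Proof.
  intros W.
  destruct (entire_deriv sigma (sigma_entire _ _ _ _ _ _ W)) as (s1 & D0 & E1).
  destruct (entire_deriv s1 E1) as (s2 & D1 & E2).
  destruct (entire_deriv s2 E2) as (s3 & D2 & E3).
  destruct (entire_deriv s3 E3) as (s4 & D3 & E4).
  destruct (entire_deriv s4 E4) as (s5 & D4 & _).
  assert (Op : forall z, sigma z <> 0 -> exists d, 0 < d /\ forall w, Cmod (w - z) < d -> sigma w <> 0).
  { intros z Hz. apply (cderiv_nonzero_open sigma z (s1 z)); auto. }
  pose proof (wp_sigma _ _ _ _ _ _ _ _ W D0 D1) as Z2.
  (* [N] is sigma^3 wp', found by differentiating wp sigma^2 = s1^2 - sigma s2, and [N'] is its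
     derivative. *)
  set (N := fun z => (3 * (sigma z * (s1 z * s2 z)) - sigma z * sigma z * s3 z - 2 * (s1 z * (s1 z * s1 z)))%C).
  set (N' := fun z => (- (3) * (s1 z * s1 z * s2 z) + 3 * (sigma z * (s2 z * s2 z))
     + sigma z * (s1 z * s3 z) - sigma z * sigma z * s4 z)%C).
  assert (DN : forall z, cderiv N z (N' z)).
  { intros z. pose proof (D0 z); pose proof (D1 z); pose proof (D2 z); pose proof (D3 z).
    eapply cderiv_eq; [unfold N; cderiv_rules|]. cbv beta. unfold N'. ring. }
  assert (Z3 : forall z, sigma z <> 0 -> (dwp z * sigma z ^ 3 = N z)%C).
  { intros z Hz. destruct (Op z Hz) as [d [Hd H]].
    pose proof (wp_cderiv _ _ _ _ _ _ W z Hz) as Dw.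
    pose proof (D0 z); pose proof (D1 z); pose proof (D2 z).
    assert (T : cderiv (fun w => wp w * (sigma w * sigma w))%C z
       (s1 z * s2 z + s1 z * s2 z - (s1 z * s2 z + sigma z * s3 z))%C).
    { apply (cderiv_ext_loc (fun w => s1 w * s1 w - sigma w * s2 w)%C _ z _ d Hd).
      - intros w Hw. pose proof (Z2 w (H w Hw)) as Q.
        replace (wp w * (sigma w * sigma w))%C with (wp w * sigma w ^ 2)%C by ring. rewrite Q. ring.
      - eapply cderiv_eq; [cderiv_rules|]. cbv beta. ring. }
    assert (T' : cderiv (fun w => wp w * (sigma w * sigma w))%C z
       (dwp z * (sigma z * sigma z) + wp z * (s1 z * sigma z + sigma z * s1 z))%C) by cderiv_rules.
    pose proof (cderiv_unique _ _ _ _ T' T) as U.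
    replace (dwp z * sigma z ^ 3)%C
      with ((dwp z * (sigma z * sigma z) + wp z * (s1 z * sigma z + sigma z * s1 z)) * sigma z
            - 2 * s1 z * (wp z * sigma z ^ 2))%C by ring.
    rewrite U, (Z2 z Hz). unfold N. ring. }
  (* This is sigma^4 (wp'' - 6 wp^2 + g2 / 2) without denominators: sigma^4 wp'' equals sigma N' - 3
     s1 N. *)
  set (Hh := fun z => (sigma z * N' z - 3 * (s1 z * N z)
     - 6 * ((s1 z * s1 z - sigma z * s2 z) * (s1 z * s1 z - sigma z * s2 z))
     + g2 / 2 * (sigma z * sigma z * (sigma z * sigma z)))%C).
  assert (HE : forall z, exists l, cderiv Hh z l).
  { intros z. pose proof (D0 z); pose proof (D1 z); pose proof (D2 z); pose proof (D3 z); pose proof (D4 z).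
    pose proof (DN z). eexists. unfold Hh, N'. cderiv_rules. }
  assert (Z4 : forall z, sigma z <> 0 -> exists l, cderiv dwp z l /\
     (dwp z * (l - (6 * wp z ^ 2 - g2 / 2)) = 0)%C /\
     Hh z = (sigma z ^ 4 * (l - (6 * wp z ^ 2 - g2 / 2)))%C).
  { intros z Hz. destruct (Op z Hz) as [d [Hd H]].
    destruct (deriv_cderiv wp dwp z d Hd) as [l Hl].
    { intros w Hw. apply (wp_cderiv _ _ _ _ _ _ W), H, Hw. }
    pose proof (wp_cderiv _ _ _ _ _ _ W z Hz) as Dw. pose proof (D0 z) as D0z.
    exists l. split; [exact Hl|]. split.
    - assert (T : cderiv (fun w => dwp w * dwp w)%C z (12 * wp z ^ 2 * dwp z - g2 * dwp z)%C).
      { apply (cderiv_ext_loc (fun w => 4 * (wp w * (wp w * wp w)) - g2 * wp w - g3)%C _ z _ d Hd).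
        - intros w Hw. pose proof (wp_cubic _ _ _ _ _ _ W w (H w Hw)) as Q.
          replace (dwp w * dwp w)%C with (dwp w ^ 2)%C by ring. rewrite Q. ring.
        - eapply cderiv_eq; [cderiv_rules|]. cbv beta. ring. }
      assert (T' : cderiv (fun w => dwp w * dwp w)%C z (l * dwp z + dwp z * l)%C) by cderiv_rules.
      pose proof (cderiv_unique _ _ _ _ T' T) as U.
      replace (dwp z * (l - (6 * wp z ^ 2 - g2 / 2)))%C
        with (((l * dwp z + dwp z * l) - (12 * wp z ^ 2 * dwp z - g2 * dwp z)) / 2)%C by field.
      rewrite U. field.
    - assert (T : cderiv (fun w => dwp w * (sigma w * (sigma w * sigma w)))%C z (N' z)).
      { apply (cderiv_ext_loc N _ z _ d Hd); [|apply DN].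
        intros w Hw. rewrite <- (Z3 w (H w Hw)). ring. }
      assert (T' : cderiv (fun w => dwp w * (sigma w * (sigma w * sigma w)))%C z
         (l * (sigma z * (sigma z * sigma z))
          + dwp z * (s1 z * (sigma z * sigma z) + sigma z * (s1 z * sigma z + sigma z * s1 z)))%C) by cderiv_rules.
      pose proof (cderiv_unique _ _ _ _ T' T) as U. unfold Hh.
      rewrite <- U, <- (Z3 z Hz).
      replace (s1 z * s1 z - sigma z * s2 z)%C with (wp z * sigma z ^ 2)%C by (rewrite Z2 by exact Hz; ring).
      ring. }
  destruct (sigma_near_0 _ _ _ _ _ _ s1 s2 W D0 D1) as (K & r & K0 & Hr & B).
  assert (S0 : sigma 0 = 0).
  { destruct (B 0) as (B0 & _); [rewrite Cmod_0; lra|]. rewrite Cmod_0 in B0.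
    replace (sigma 0 - 0)%C with (sigma 0) in B0 by ring.
    apply Cmod_eq_0. apply Rle_antisym; [|apply Cmod_ge_0]. simpl in B0. lra. }
  assert (S1 : s1 0 = 1).
  { destruct (B 0) as (_ & B1 & _); [rewrite Cmod_0; lra|]. rewrite Cmod_0 in B1.
    apply Ceq_minus. apply Cmod_eq_0. apply Rle_antisym; [|apply Cmod_ge_0]. simpl in B1. lra. }
  (* The value N 0 = -2 reflects the leading term - 2 / u^3 of wp', so wp' has no zero on a small
     punctured disc. *)
  destruct (cderiv_nonzero_open N 0 _ (DN 0)) as [d [Hd HN]].
  { unfold N. rewrite S0, S1. intros E. 
    replace (3 * (0 * (1 * s2 0)) - 0 * 0 * s3 0 - 2 * (1 * (1 * 1)))%C with (RtoC (- 2)) in E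
      by ring.
    apply RtoC_inj in E. lra. }
  assert (HZ : forall z, Hh z = 0).
  { apply (entire_zero Hh (Rmin r d)); [exact HE|apply Rmin_glb_lt; lra|].
    intros z Hz. pose proof (Rmin_l r d). pose proof (Rmin_r r d).
    destruct (B z) as (_ & _ & _ & B3); [lra|].
    assert (Sz : sigma z <> 0) by (apply Cmod_pos_neq_0; lra).
    destruct (Z4 z Sz) as (l & _ & P1 & P2). rewrite P2.
    assert (Dz : dwp z <> 0).
    { intros E. apply (HN z); [replace (z - 0)%C with z by ring; lra|].
      rewrite <- (Z3 z Sz), E. ring. }
    replace (l - (6 * wp z ^ 2 - g2 / 2))%C with (/ dwp z * (dwp z * (l - (6 * wp z ^ 2 - g2 / 2))))%C
      by (field; exact Dz).
    rewrite P1. ring. }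
  intros z Hz. destruct (Z4 z Hz) as (l & Hl & _ & P2). rewrite HZ in P2.
  eapply cderiv_eq; [exact Hl|]. apply Ceq_minus.
  pose proof (Cpow_nz (sigma z) 4 Hz) as P4.
  set (x := (l - (6 * wp z ^ 2 - g2 / 2))%C) in *.
  replace x with (/ sigma z ^ 4 * (sigma z ^ 4 * x))%C by (field; exact Hz).
  rewrite <- P2. ring.
Qed.

Lemma zeta_wp_near_0 (g2 g3 : C) (sigma zeta wp dwp : C -> C) :
  weierstrass g2 g3 sigma zeta wp dwp ->
  exists K r, 0 <= K /\ 0 < r <= 1 /\ forall u, 0 < Cmod u < r ->
    sigma u <> 0 /\ Cmod (zeta u - / u) <= K * Cmod u ^ 2 /\ Cmod (wp u - / (u * u)) <= K * Cmod u.
Proof.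
  intros W.
  destruct (entire_deriv sigma (sigma_entire _ _ _ _ _ _ W)) as (s1 & D0 & E1).
  destruct (entire_deriv s1 E1) as (s2 & D1 & _).
  destruct (sigma_near_0 _ _ _ _ _ _ s1 s2 W D0 D1) as (K & r & K0 & Hr & B).
  (* With a = zeta u - 1 / u of size 4 K |u|^3, the difference wp u - 1 / u^2 = a (a + 2 / u) - s2 u
     / sigma u is at most 16 K^2 |u|^6 + 8 K |u|^2 + 2 K |u|^2; the powers then collapse because |u|
     <= 1. *)
  exists (16 * K * K + 10 * K), r. split; [nra|]. split; [exact Hr|].
  intros u Hu. destruct (B u) as (B0 & B1 & B2 & B3); [lra|].
  set (x := Cmod u) in *.
  assert (Sz : sigma u <> 0) by (apply Cmod_pos_neq_0; lra).
  assert (Uz : u <> 0) by (apply Cmod_pos_neq_0; fold x; lra).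
  pose proof (zeta_sigma _ _ _ _ _ _ _ W D0 u Sz) as Z1.
  pose proof (wp_sigma _ _ _ _ _ _ _ _ W D0 D1 u Sz) as Z2.
  split; [exact Sz|].
  set (a := (zeta u - / u)%C).
  assert (Ha : Cmod a <= 4 * K * x ^ 3).
  { replace a with ((u * (s1 u - 1) - (sigma u - u)) / (u * sigma u))%C
      by (unfold a; rewrite <- Z1; field; auto).
    rewrite Cmod_div by (apply Cmult_neq_0; assumption). rewrite Cmod_mult. fold x.
    apply Rle_trans with (2 * K * x ^ 5 / (x * (x / 2))).
    - apply Rmult_le_compat; [apply Cmod_ge_0| | |].
      + apply Rlt_le, Rinv_0_lt_compat, Rmult_lt_0_compat; lra.
      + unfold Cminus at 1. eapply Rle_trans; [apply Cmod_triangle|].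
        rewrite Cmod_opp, Cmod_mult. fold x.
        assert (x * Cmod (s1 u - 1) <= x * (K * x ^ 4)) by (apply Rmult_le_compat_l; lra).
        replace (x * (K * x ^ 4)) with (K * x ^ 5) in H by ring. lra.
      + apply Rinv_le_contravar; [nra|]. apply Rmult_le_compat_l; lra.
    - right. field. lra. }
  assert (x2 : x ^ 2 <= x) by nra.
  assert (x3 : x ^ 3 <= x ^ 2) by nra.
  assert (x20 : 0 <= x ^ 2) by nra. assert (x30 : 0 <= x ^ 3) by nra.
  split; [nra|].
  replace (wp u - / (u * u))%C with (a * (a + 2 / u) - s2 u / sigma u)%C.
  2:{ assert (Wp : wp u = (zeta u * zeta u - s2 u / sigma u)%C).
      { replace (wp u) with (wp u * sigma u ^ 2 / sigma u ^ 2)%C by (field; exact Sz).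
        rewrite Z2, <- Z1. field. exact Sz. }
      rewrite Wp. unfold a. field. auto. }
  unfold Cminus at 1. eapply Rle_trans; [apply Cmod_triangle|].
  rewrite Cmod_opp, Cmod_mult, (Cmod_div (s2 u)) by exact Sz.
  assert (A1 : Cmod (a + 2 / u) <= 4 * K * x ^ 3 + 2 / x).
  { eapply Rle_trans; [apply Cmod_triangle|]. rewrite Cmod_div, Cmod_R, Rabs_pos_eq by (exact Uz || lra).
    fold x. lra. }
  assert (A2 : Cmod (s2 u) / Cmod (sigma u) <= K * x ^ 3 / (x / 2)).
  { apply Rmult_le_compat; [apply Cmod_ge_0| |exact B2|].
    - apply Rlt_le, Rinv_0_lt_compat; lra.
    - apply Rinv_le_contravar; lra. }
  assert (A3 : Cmod a * Cmod (a + 2 / u) <= 4 * K * x ^ 3 * (4 * K * x ^ 3 + 2 / x)).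
  { apply Rmult_le_compat; auto using Cmod_ge_0. }
  replace (K * x ^ 3 / (x / 2)) with (2 * K * x ^ 2) in A2 by (field; lra).
  replace (4 * K * x ^ 3 * (4 * K * x ^ 3 + 2 / x)) with (16 * (K * K) * (x ^ 3 * x ^ 3) + 8 * K * x ^ 2)
    in A3 by (field; lra).
  assert (x6 : x ^ 3 * x ^ 3 <= x).
  { apply Rle_trans with (x * 1); [|lra]. apply Rmult_le_compat; lra. }
  assert (KK : 0 <= K * K) by nra.
  assert (16 * (K * K) * (x ^ 3 * x ^ 3) <= 16 * (K * K) * x) by (apply Rmult_le_compat_l; lra).
  assert (K * x ^ 2 <= K * x) by (apply Rmult_le_compat_l; lra).
  lra.
Qed.

(** * The addition theorem *)

Lemma linear_small_nonpos (x c s : R) :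
  0 <= c -> 0 < s -> (forall t, 0 < t <= 1 -> x <= c * (t * s)) -> x <= 0.
Proof.
  intros Hc Hs H. apply Rnot_lt_le. intros Hx.
  set (q := x / (2 * (c * s + 1))).
  assert (P : 0 <= c * s) by nra.
  assert (Hq : 0 < q) by (apply Rdiv_lt_0_compat; lra).
  specialize (H (Rmin 1 q)). pose proof (Rmin_l 1 q). pose proof (Rmin_r 1 q).
  assert (0 < Rmin 1 q) by (apply Rmin_glb_lt; lra).
  specialize (H ltac:(lra)).
  assert (c * (Rmin 1 q * s) <= (c * s + 1) * q) by nra.
  replace ((c * s + 1) * q) with (x / 2) in H3 by (unfold q; field; lra). lra.
Qed.

(** A ray stays in the punctured disc and leads to its centre, where the constant can be read off.
    Derivatives are required only at points of the ray, because the addition theorem applies this to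
    a function containing a constant known on that ray alone. *)
Lemma cderiv_ray_const (f : C -> C) (u : C) :
  (forall t, 0 < t <= 1 -> cderiv f (RtoC t * u)%C 0) ->
  forall t, 0 < t <= 1 -> f (RtoC t * u)%C = f u.
Proof.
  intros H t Ht. destruct (Req_dec t 1) as [->|N]; [f_equal; ring|].
  replace (f u) with (f (RtoC 1 * u)%C) by (f_equal; ring).
  apply (eq_is_derive (V := C_R_NormedModule) (fun s => f (RtoC s * u)%C) t 1); [|lra].
  intros s Hs.
  assert (A : rderiv (fun s => RtoC s * u)%C s u).
  { apply (is_derive_ext (V := C_R_NormedModule) (fun s => 0 + RtoC s * u)%C);
      [intros x; apply Cplus_0_l|apply rderiv_affine]. }
  pose proof (rderiv_comp f (fun s => RtoC s * u)%C s 0 u (H s ltac:(lra)) A) as B.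
  replace (0 * u)%C with (RtoC 0) in B by ring. exact B.
Qed.

Lemma cderiv_reflect (f : C -> C) (v u l : C) :
  cderiv f (v - u)%C l -> cderiv (fun w => f (v - w)%C) u (- l)%C.
Proof.
  intros H. eapply cderiv_eq.
  - apply (cderiv_comp f (fun w => v - w)%C u l (- (1))%C H).
    eapply cderiv_eq; [cderiv_rules|]. ring.
  - ring.
Qed.

(* With [L = zeta(u) + zeta(v - u) - zeta(v)], [A = wp(u)], [B = wp(v - u)], the function
   [L + (A' - B') / (2 (A - B))] has derivative zero, say it is [c] along a ray; then
   [L^2 - A - B - wp(v) - 2 c L] has derivative zero along that ray.
   The expansions at [u = 0] force both constants to vanish. *)
Lemma zeta_addition (g2 g3 : C) (sigma zeta wp dwp : C -> C) (v : C) :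
  weierstrass g2 g3 sigma zeta wp dwp -> sigma v <> 0 ->
  exists r, 0 < r /\ forall u, Cmod u < r -> sigma (v - u)%C <> 0 /\
    (u <> 0 -> sigma u <> 0 /\
      ((zeta u + zeta (v - u) - zeta v) ^ 2 = wp u + wp (v - u) + wp v)%C).
Proof.
  intros W Hv.
  destruct (zeta_wp_near_0 _ _ _ _ _ _ W) as (K & r0 & K0 & Hr0 & B0).
  destruct (cderiv_nonzero_open sigma v _ (sigma_cderiv _ _ _ _ _ _ W v Hv) Hv) as [d [Hd Hnz]].
  assert (Hnz' : forall u, Cmod u < d -> sigma (v - u)%C <> 0).
  { intros u Hu. apply Hnz. replace (v - u - v)%C with (- u)%C by ring. rewrite Cmod_opp. exact Hu. }
  assert (Dz : forall u, Cmod u < d -> cderiv (fun w => zeta (v - w)%C) u (wp (v - u)%C)).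
  { intros u Hu. eapply cderiv_eq; [apply cderiv_reflect, (zeta_cderiv _ _ _ _ _ _ W), Hnz', Hu|]. ring. }
  assert (Dw : forall u, Cmod u < d -> cderiv (fun w => wp (v - w)%C) u (- dwp (v - u))%C).
  { intros u Hu. apply cderiv_reflect, (wp_cderiv _ _ _ _ _ _ W), Hnz', Hu. }
  assert (Dd : forall u, Cmod u < d -> cderiv (fun w => dwp (v - w)%C) u (- (6 * wp (v - u) ^ 2 - g2 / 2))%C).
  { intros u Hu. apply cderiv_reflect, (wp_second_derivative _ _ _ _ _ _ W), Hnz', Hu. }
  assert (C0 : Cmod 0 < d) by (rewrite Cmod_0; exact Hd).
  destruct (holo_first_order (fun w => zeta (v - w)%C) _ d Hd (fun u Hu => ex_intro _ _ (Dz u Hu)) (Dz 0 C0))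
    as (K3 & r3 & K30 & Hr3 & B3).
  destruct (proj1 (cderiv_spec _ _ _) (Dw 0 C0) 1 Rlt_0_1) as [r4 [Hr4 B4]].
  replace (v - 0)%C with v in * by ring.
  set (K4 := Cmod (dwp v) + 1). pose proof (Cmod_ge_0 (dwp v)) as Dv0. pose proof (Cmod_ge_0 (wp v)) as Wv0.
  (* For |w| < 1 / Q the pole 1 / w^2 of wp outweighs all the other terms, so wp w and wp (v - w)
     differ and [Dn] may be divided by. *)
  set (Q := K + Cmod (wp v) + K4 + 1). assert (HQ : 0 < Q) by (unfold Q, K4; lra).
  set (r := Rmin (Rmin (Rmin r0 d) (Rmin r3 r4)) (/ Q)).
  assert (Hr : 0 < r).
  { unfold r. repeat apply Rmin_glb_lt; try lra. apply Rinv_0_lt_compat, HQ. }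
  assert (Rr : r <= r0 /\ r <= d /\ r <= r3 /\ r <= r4 /\ r <= / Q).
  { unfold r. pose proof (Rmin_l (Rmin (Rmin r0 d) (Rmin r3 r4)) (/ Q)).
    pose proof (Rmin_r (Rmin (Rmin r0 d) (Rmin r3 r4)) (/ Q)).
    pose proof (Rmin_l (Rmin r0 d) (Rmin r3 r4)). pose proof (Rmin_r (Rmin r0 d) (Rmin r3 r4)).
    pose proof (Rmin_l r0 d). pose proof (Rmin_r r0 d). pose proof (Rmin_l r3 r4). pose proof (Rmin_r r3 r4).
    lra. }
  destruct Rr as (R1 & R2 & R3 & R4 & R5).
  exists r. split; [exact Hr|]. intros u Hu. split; [apply Hnz'; lra|].
  intros Hu0. apply Cmod_gt_0 in Hu0. split; [apply B0; lra|].
  set (L := fun w => (zeta w + zeta (v - w) - zeta v)%C).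
  set (Dn := fun w => (wp w - wp (v - w))%C).
  set (N := fun w => (dwp w - dwp (v - w))%C).
  set (E := fun w => (L w * L w - wp w - wp (v - w) - wp v)%C).
  set (K5 := K + K3).
  (* The first bound says L w = 1 / w + wp v w + O(w^2): there is no constant term, since zeta (v -
     w) starts with zeta v. *)
  assert (Best : forall w, 0 < Cmod w < r ->
     Cmod (L w - / w - wp v * w) <= K5 * Cmod w ^ 2 /\ Cmod (wp (v - w)%C - wp v) <= K4 * Cmod w /\ Dn w <> 0).
  { intros w Hw. destruct (B0 w) as (_ & Bz & Bw); [lra|].
    specialize (B3 w ltac:(lra)). cbv beta in B3.
    specialize (B4 w). cbv beta in B4. replace (w - 0)%C with w in * by ring. specialize (B4 ltac:(lra)).
    replace (v - 0)%C with v in * by ring.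
    assert (X4 : Cmod (wp (v - w)%C - wp v) <= K4 * Cmod w).
    { replace (wp (v - w) - wp v)%C with ((wp (v - w) - wp v - - dwp v * w) + - dwp v * w)%C by ring.
      eapply Rle_trans; [apply Cmod_triangle|]. rewrite Cmod_mult, Cmod_opp. unfold K4. lra. }
    split; [|split; [exact X4|]].
    - unfold L. replace (zeta w + zeta (v - w) - zeta v - / w - wp v * w)%C
        with ((zeta w - / w) + (zeta (v - w) - zeta v - wp v * w))%C by ring.
      eapply Rle_trans; [apply Cmod_triangle|]. unfold K5. lra.
    - intros Z. unfold Dn in Z.
      assert (Wn : w <> 0) by (apply Cmod_pos_neq_0; lra).
      assert (Y : Cmod (/ (w * w)) <= K * Cmod w + K4 * Cmod w + Cmod (wp v)).
      { replace (/ (w * w))%C with (- (wp w - / (w * w)) + (wp (v - w) - wp v) + wp v + (wp w - wp (v - w)))%C by ring.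
        rewrite Z, Cplus_0_r.
        eapply Rle_trans; [apply Cmod_triangle|].
        eapply Rle_trans; [apply Rplus_le_compat_r, Cmod_triangle|].
        rewrite Cmod_opp. lra. }
      rewrite Cmod_inv, Cmod_mult in Y by (apply Cmult_neq_0; exact Wn).
      assert (I1 : Q < / Cmod w).
      { rewrite <- (Rinv_inv Q). apply Rinv_lt_contravar; [|lra].
        apply Rmult_lt_0_compat; [lra|apply Rinv_0_lt_compat, HQ]. }
      assert (I2 : / Cmod w <= / (Cmod w * Cmod w)) by (apply Rinv_le_contravar; nra).
      assert (K * Cmod w <= K * 1) by (apply Rmult_le_compat_l; lra).
      assert (K4 * Cmod w <= K4 * 1) by (apply Rmult_le_compat_l; [unfold K4; lra|lra]).
      unfold Q in I1. lra. }
  assert (K50 : 0 <= K5) by (unfold K5; lra). assert (K40 : 0 <= K4) by (unfold K4; lra).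
  set (K7 := Cmod (wp v) + K5).
  set (K6 := 2 * K5 + K7 * K7 + K + K4).
  assert (K70 : 0 <= K7) by (unfold K7; lra). assert (K60 : 0 <= K6) by (unfold K6; nra).
  assert (BL : forall w, 0 < Cmod w < r -> Cmod (L w - / w) <= K7 * Cmod w).
  { intros w Hw. destruct (Best w Hw) as (X & _ & _).
    replace (L w - / w)%C with ((L w - / w - wp v * w) + wp v * w)%C by ring.
    eapply Rle_trans; [apply Cmod_triangle|]. rewrite Cmod_mult. unfold K7.
    assert (K5 * Cmod w ^ 2 <= K5 * Cmod w) by (apply Rmult_le_compat_l; [lra|nra]). lra. }
  (* The square of L starts with 1 / w^2 + 2 wp v, which cancels against wp w, wp (v - w) and wp v
     up to O(w). *)
  assert (BE : forall w, 0 < Cmod w < r -> Cmod (E w) <= K6 * Cmod w).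
  { intros w Hw. destruct (Best w Hw) as (X & X4 & _). pose proof (BL w Hw) as XL.
    destruct (B0 w) as (_ & _ & Bw); [lra|].
    assert (Wn : w <> 0) by (apply Cmod_pos_neq_0; lra).
    set (p := (L w - / w - wp v * w)%C) in *. set (x := Cmod w) in *.
    assert (Hx : Cmod (2 * p / w) <= 2 * K5 * x).
    { rewrite Cmod_div, Cmod_mult, Cmod_R, Rabs_pos_eq by (exact Wn || lra). fold x.
      apply Rle_trans with (2 * (K5 * x ^ 2) / x).
      - apply Rmult_le_compat_r; [apply Rlt_le, Rinv_0_lt_compat; lra|lra].
      - right. field. lra. }
    assert (Hx2 : Cmod ((L w - / w) * (L w - / w)) <= K7 * K7 * x).
    { rewrite Cmod_mult. apply Rle_trans with ((K7 * x) * (K7 * x)).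
      - apply Rmult_le_compat; auto using Cmod_ge_0.
      - replace (K7 * x * (K7 * x)) with (K7 * K7 * (x * x)) by ring.
        apply Rmult_le_compat_l; nra. }
    replace (E w) with (2 * p / w + (L w - / w) * (L w - / w) - (wp w - / (w * w)) - (wp (v - w) - wp v))%C
      by (unfold E, p; field; exact Wn).
    unfold Cminus at 1 2. eapply Rle_trans; [apply Cmod_triangle|].
    eapply Rle_trans; [apply Rplus_le_compat_r, Cmod_triangle|].
    eapply Rle_trans; [apply Rplus_le_compat_r, Rplus_le_compat_r, Cmod_triangle|].
    rewrite !Cmod_opp. unfold K6. lra. }
  assert (Ray : forall t, 0 < t <= 1 -> 0 < Cmod (t * u) < r /\ Cmod (t * u) = t * Cmod u).
  { intros t Ht. assert (T : Cmod (t * u) = t * Cmod u) by (rewrite Cmod_mult, Cmod_R, Rabs_pos_eq; lra).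
    rewrite T. split; [split; nra|reflexivity]. }
  assert (Der : forall w, 0 < Cmod w < r ->
     cderiv L w (wp (v - w) - wp w)%C /\ cderiv Dn w (dwp w + dwp (v - w))%C /\
     cderiv N w (6 * wp w ^ 2 - g2 / 2 + (6 * wp (v - w) ^ 2 - g2 / 2))%C /\
     cderiv (fun w => wp w + wp (v - w))%C w (dwp w - dwp (v - w))%C).
  { intros w Hw. destruct (B0 w) as (Sw & _ & _); [lra|].
    pose proof (Dz w ltac:(lra)). pose proof (Dw w ltac:(lra)). pose proof (Dd w ltac:(lra)).
    pose proof (zeta_cderiv _ _ _ _ _ _ W w Sw). pose proof (wp_cderiv _ _ _ _ _ _ W w Sw).
    pose proof (wp_second_derivative _ _ _ _ _ _ W w Sw).
    split; [|split; [|split]]; (eapply cderiv_eq; [unfold L, Dn, N; cderiv_rules|cbv beta; ring]). }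
  assert (CubicDiff : forall w, 0 < Cmod w < r ->
     ((dwp w - dwp (v - w)) * (dwp w + dwp (v - w))
      = 4 * wp w ^ 3 - g2 * wp w - (4 * wp (v - w) ^ 3 - g2 * wp (v - w)))%C).
  { intros w Hw. destruct (B0 w) as (Sw & _ & _); [lra|].
    pose proof (wp_cubic _ _ _ _ _ _ W w Sw) as Q1.
    pose proof (wp_cubic _ _ _ _ _ _ W (v - w)%C (Hnz' w ltac:(lra))) as Q2.
    replace ((dwp w - dwp (v - w)) * (dwp w + dwp (v - w)))%C with (dwp w ^ 2 - dwp (v - w) ^ 2)%C by ring.
    rewrite Q1, Q2. ring. }
  set (X := fun w => (L w + N w * / (2 * Dn w))%C).
  assert (DX : forall w, 0 < Cmod w < r -> cderiv X w 0).
  { intros w Hw. destruct (Der w Hw) as (H1 & H2 & H3 & _). destruct (Best w Hw) as (_ & _ & Dn0).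
    assert (T0 : (2 * Dn w)%C <> 0).
    { apply Cmult_neq_0; [|exact Dn0]. intros Z. apply RtoC_inj in Z. lra. }
    pose proof (cderiv_inv (fun w => 2 * Dn w)%C w _ T0
      (cderiv_mult _ _ _ _ _ (cderiv_const (RtoC 2) w) H2)) as H5.
    eapply cderiv_eq; [unfold X; cderiv_rules|].
    pose proof (CubicDiff w Hw) as CD. cbv beta. unfold N.
    set (a := wp w) in *. set (b := wp (v - w)%C) in *.
    replace (Dn w) with (a - b)%C in * by reflexivity.
    set (a' := dwp w) in *. set (b' := dwp (v - w)%C) in *.
    (* By the cubic relation the numerator equals 2 (a - b)^3, so the fraction is a - b and cancels
       b - a. *)
    transitivity (b - a + ((6 * a ^ 2 - g2 / 2 + (6 * b ^ 2 - g2 / 2)) * (a - b)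
      - (a' - b') * (a' + b')) / (2 * (a - b) * (a - b)))%C.
    - field. exact Dn0.
    - rewrite CD. field. exact Dn0. }
  set (c := X u).
  assert (Xc : forall t, 0 < t <= 1 -> X (RtoC t * u)%C = c).
  { apply cderiv_ray_const. intros t Ht. apply DX, Ray, Ht. }
  (* Since L' = - Dn, the derivative of E is - 2 Dn X, which along the ray is 2 c L'; this explains
     the correction 2 c L. *)
  set (G := fun w => (E w - 2 * c * L w)%C).
  assert (Gc : forall t, 0 < t <= 1 -> G (RtoC t * u)%C = G u).
  { apply cderiv_ray_const. intros t Ht. destruct (Ray t Ht) as [Hw _]. specialize (Xc t Ht).
    set (w := (RtoC t * u)%C) in *.
    destruct (Der w Hw) as (H1 & _ & _ & H4). destruct (Best w Hw) as (_ & _ & Dn0).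
    apply (cderiv_ext_loc (fun w => L w * L w - (wp w + wp (v - w)) - wp v - 2 * c * L w)%C G w _ 1 Rlt_0_1).
    { intros y _. unfold G, E. ring. }
    eapply cderiv_eq; [|].
    { apply (cderiv_minus (fun w => L w * L w - (wp w + wp (v - w)) - wp v)%C (fun w => 2 * c * L w)%C).
      - apply (cderiv_minus (fun w => L w * L w - (wp w + wp (v - w)))%C (fun _ => wp v)); [|apply cderiv_const].
        apply (cderiv_minus (fun w => L w * L w)%C (fun w => wp w + wp (v - w))%C); [|exact H4].
        cderiv_rules.
      - cderiv_rules. }
    cbv beta. rewrite <- Xc. unfold X.
    replace (dwp w - dwp (v - w))%C with (N w) by reflexivity.
    replace (wp (v - w) - wp w)%C with (- Dn w)%C by (unfold Dn; ring).
    field. exact Dn0. }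
  set (g := G u) in *.
  (* E is bounded and E - 2 c L is constant, while L has the pole 1 / w. Multiplying by w shows that
     2 c is O(w). *)
  assert (c0 : c = 0).
  { apply Cmod_eq_0. apply Rle_antisym; [|apply Cmod_ge_0].
    apply (linear_small_nonpos _ (2 * Cmod c * K7 + K6 + Cmod g) (Cmod u)); [|exact Hu0|].
    { pose proof (Cmod_ge_0 c). pose proof (Cmod_ge_0 g). nra. }
    intros t Ht. destruct (Ray t Ht) as [Hw Tw]. specialize (Gc t Ht). rewrite <- Tw.
    set (w := (RtoC t * u)%C) in *.
    pose proof (BE w Hw) as B1. pose proof (BL w Hw) as B2.
    assert (Wn : w <> 0) by (apply Cmod_pos_neq_0; lra).
    assert (Id : (2 * c = w * (E w - g - 2 * c * (L w - / w)))%C).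
    { unfold G in Gc. rewrite <- Gc. field. exact Wn. }
    assert (Id2 : Cmod (2 * c) = 2 * Cmod c) by (rewrite Cmod_mult, Cmod_R, Rabs_pos_eq; lra).
    rewrite Id, Cmod_mult in Id2.
    assert (T : Cmod (E w - g - 2 * c * (L w - / w)) <= K6 * Cmod w + Cmod g + 2 * Cmod c * (K7 * Cmod w)).
    { unfold Cminus at 1 2. eapply Rle_trans; [apply Cmod_triangle|].
      eapply Rle_trans; [apply Rplus_le_compat_r, Cmod_triangle|].
      rewrite !Cmod_opp, !Cmod_mult, Cmod_R, Rabs_pos_eq by lra.
      assert (2 * Cmod c * Cmod (L w - / w) <= 2 * Cmod c * (K7 * Cmod w)).
      { apply Rmult_le_compat_l; [pose proof (Cmod_ge_0 c); lra|exact B2]. }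
      lra. }
    pose proof (Cmod_ge_0 c) as c00. pose proof (Cmod_ge_0 g) as g00.
    set (x := Cmod w) in *.
    assert (Q1 : x * Cmod (E w - g - 2 * c * (L w - / w)) <= x * (K6 + Cmod g + 2 * Cmod c * K7)).
    { apply Rmult_le_compat_l; [lra|]. eapply Rle_trans; [exact T|].
      assert (K6 * x <= K6 * 1) by (apply Rmult_le_compat_l; lra).
      assert (Cmod c * (K7 * x) <= Cmod c * (K7 * 1)).
      { apply Rmult_le_compat_l; [lra|]. apply Rmult_le_compat_l; lra. }
      lra. }
    lra. }
  assert (g0 : g = 0).
  { apply Cmod_eq_0. apply Rle_antisym; [|apply Cmod_ge_0].
    apply (linear_small_nonpos _ K6 (Cmod u)); [exact K60|exact Hu0|].
    intros t Ht. destruct (Ray t Ht) as [Hw Tw]. rewrite <- (Gc t Ht), <- Tw.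
    unfold G. rewrite c0. replace (E (t * u) - 2 * 0 * L (t * u))%C with (E (t * u)%C) by ring.
    apply BE, Hw. }
  unfold g, G in g0. rewrite c0 in g0. unfold E, L in g0.
  apply Ceq_minus. rewrite <- g0. ring.
Qed.

(** * The linear equation of 1 / Phi and its Taylor coefficients *)

Lemma holo_exists_deriv (f : C -> C) (R : R) :
  holo R f -> exists f', forall w, Cmod w < R -> cderiv f w (f' w).
Proof. intros H. exists (C_derive f). intros w Hw. apply cderiv_C_derive, H, Hw. Qed.

(* Unlike the Lame equation [Phi'' = (2 wp(u) + wp(v)) Phi], this one has no pole at [u = 0]. *)
Lemma BA_inv_ode (g2 g3 : C) (sigma zeta wp dwp : C -> C) (v : C) :
  weierstrass g2 g3 sigma zeta wp dwp -> sigma v <> 0 ->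
  exists (r : R) (f f1 : C -> C), 0 < r /\ f 0 = 0 /\ f1 0 = 1 /\
    (forall u : C, u <> 0 -> Cmod u < r -> f u = (/ BA sigma zeta u v)%C) /\
    forall u, Cmod u < r -> sigma (v - u)%C <> 0 /\
      cderiv f u (f1 u) /\ cderiv f1 u ((2 * wp (v - u) + wp v) * f u)%C.
Proof.
  intros W Hv. destruct (zeta_addition _ _ _ _ _ _ v W Hv) as (r & Hr & Add).
  destruct (entire_deriv sigma (sigma_entire _ _ _ _ _ _ W)) as (s1 & D0 & E1).
  destruct (entire_deriv s1 E1) as (s2 & D1 & _).
  destruct (sigma_near_0 _ _ _ _ _ _ s1 s2 W D0 D1) as (K & r0 & K0 & Hr0 & B).
  destruct (B 0) as (B0 & B1 & _ & _); [rewrite Cmod_0; lra|]. rewrite Cmod_0 in B0, B1.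
  assert (S0 : sigma 0 = 0).
  { replace (sigma 0 - 0)%C with (sigma 0) in B0 by ring.
    apply Cmod_eq_0. apply Rle_antisym; [|apply Cmod_ge_0]. simpl in B0. lra. }
  assert (S1 : s1 0 = 1).
  { apply Ceq_minus. apply Cmod_eq_0. apply Rle_antisym; [|apply Cmod_ge_0]. simpl in B1. lra. }
  clear B B0 B1.
  (* This is 1 / Phi with sigma u moved to the numerator, hence meaningful at u = 0, where Phi has a
     pole. *)
  set (f := fun u => (sigma u * (sigma v * / sigma (v - u)) * Cexp (- (zeta v * u)))%C).
  assert (Df : forall u, Cmod u < r -> cderiv f u
     ((s1 u + sigma u * (s1 (v - u) / sigma (v - u) - zeta v)) * (sigma v * / sigma (v - u)) * Cexp (- (zeta v * u)))%C).
  { intros u Hu. destruct (Add u Hu) as [Nz _].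
    pose proof (D0 u) as Du.
    pose proof (cderiv_reflect sigma v u _ (D0 (v - u)%C)) as Dvu.
    pose proof (cderiv_inv (fun w => sigma (v - w)%C) u _ Nz Dvu) as Di.
    assert (De : cderiv (fun w => Cexp (- (zeta v * w))) u (Cexp (- (zeta v * u)) * - zeta v)%C).
    { apply (cderiv_comp Cexp (fun w => - (zeta v * w))%C u); [apply cderiv_Cexp|].
      eapply cderiv_eq; [cderiv_rules|]. cbv beta. ring. }
    eapply cderiv_eq; [unfold f; cderiv_rules|]. cbv beta. field. exact Nz. }
  (* The explicit derivative just found contains no zeta u and gives f1 also at 0. Holomorphy makes
     [f2] differentiable there, which the passage to u = 0 in the differential equation requires. *)
  destruct (holo_exists_deriv f r) as [f1 Df1]; [intros w Hw; eexists; apply Df, Hw|].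
  destruct (holo_exists_deriv f1 r (holo_deriv f f1 r Hr Df1)) as [f2 Df2].
  pose proof (holo_deriv f1 f2 r Hr Df2) as Hf2.
  assert (C0 : Cmod 0 < r) by (rewrite Cmod_0; exact Hr).
  assert (F0 : f 0 = 0) by (unfold f; rewrite S0; ring).
  set (L := fun u => (zeta u + zeta (v - u) - zeta v)%C).
  assert (FL : forall u, Cmod u < r -> u <> 0 -> f1 u = (L u * f u)%C).
  { intros u Hu Hu0. destruct (Add u Hu) as [Nz Nu]. destruct (Nu Hu0) as [Su _].
    rewrite (cderiv_unique _ _ _ _ (Df1 u Hu) (Df u Hu)). unfold f, L.
    rewrite <- (zeta_sigma _ _ _ _ _ _ _ W D0 u Su), <- (zeta_sigma _ _ _ _ _ _ _ W D0 _ Nz).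
    field. exact Nz. }
  assert (F2 : forall u, Cmod u < r -> u <> 0 -> f2 u = ((2 * wp (v - u) + wp v) * f u)%C).
  { intros u Hu Hu0. destruct (Add u Hu) as [Nz Nu]. destruct (Nu Hu0) as [Su Eq].
    pose proof (proj1 (Cmod_gt_0 u) Hu0) as U0.
    pose proof (zeta_cderiv _ _ _ _ _ _ W u Su) as Z1.
    pose proof (cderiv_reflect zeta v u _ (zeta_cderiv _ _ _ _ _ _ W _ Nz)) as Z2.
    pose proof (Df1 u Hu) as Z3.
    assert (T : cderiv f1 u ((- wp u + wp (v - u)) * f u + L u * f1 u)%C).
    { apply (cderiv_ext_loc (fun w => L w * f w)%C f1 u _ (Rmin (Cmod u) (r - Cmod u))).
      - apply Rmin_glb_lt; lra.
      - intros w Hw. pose proof (Rmin_l (Cmod u) (r - Cmod u)). pose proof (Rmin_r (Cmod u) (r - Cmod u)).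
        symmetry. apply FL.
        + replace w with (w - u + u)%C by ring. eapply Rle_lt_trans; [apply Cmod_triangle|]. lra.
        + intros Z. rewrite Z in Hw. replace (0 - u)%C with (- u)%C in Hw by ring.
          rewrite Cmod_opp in Hw. lra.
      - eapply cderiv_eq; [unfold L; cderiv_rules|]. cbv beta. unfold L. ring. }
    rewrite (cderiv_unique _ _ _ _ (Df2 u Hu) T), (FL u Hu Hu0).
    replace ((- wp u + wp (v - u)) * f u + L u * (L u * f u))%C
      with ((- wp u + wp (v - u) + L u ^ 2) * f u)%C by ring.
    unfold L. rewrite Eq. ring. }
  exists r, f, f1. split; [exact Hr|]. split; [exact F0|]. split; [|split].
  - rewrite (cderiv_unique _ _ _ _ (Df1 0 C0) (Df 0 C0)), S0, S1.
    replace (v - 0)%C with v by ring. replace (- (zeta v * 0))%C with (RtoC 0) by ring.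
    rewrite Cexp_0. field. exact Hv.
  - intros u Hu0 Hu. destruct (Add u Hu) as [Nz Nu]. destruct (Nu Hu0) as [Su _].
    assert (Ex : Cexp (- (zeta v * u)) = (/ Cexp (zeta v * u))%C).
    { pose proof (Cexp_plus (- (zeta v * u)) (zeta v * u)) as P.
      replace (- (zeta v * u) + zeta v * u)%C with (RtoC 0) in P by ring. rewrite Cexp_0 in P.
      pose proof (Cexp_neq_0 (zeta v * u)) as Ne.
      replace (Cexp (- (zeta v * u))) with (Cexp (- (zeta v * u)) * Cexp (zeta v * u) / Cexp (zeta v * u))%C
        by (field; exact Ne).
      rewrite <- P. field. exact Ne. }
    unfold f, BA. rewrite Ex. field. repeat split; auto. apply Cexp_neq_0.
  - intros u Hu. destruct (Add u Hu) as [Nz _]. split; [exact Nz|]. split; [apply Df1, Hu|].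
    eapply cderiv_eq; [apply Df2, Hu|].
    destruct (Ceq_dec u 0) as [->|Hu0]; [|apply F2; assumption].
    destruct (Hf2 0 C0) as [m Hm].
    pose proof (Df1 0 C0) as Z3.
    pose proof (cderiv_reflect wp v 0 _ (wp_cderiv _ _ _ _ _ _ W _ Nz)) as Z4.
    eapply (cderiv_eq_at f2 (fun u => (2 * wp (v - u) + wp v) * f u)%C 0 m _ r Hr Hm).
    + cderiv_rules.
    + intros w Hw. replace (w - 0)%C with w in Hw by ring. apply F2; [lra|].
      apply Cmod_pos_neq_0. lra.
Qed.

Theorem mainTheorem11 :
  exists P : nat -> zpoly3,
  forall (g2 g3 : C) (sigma zeta wp dwp : C -> C),
    (* sigma is entire *)
    (forall z : C, ex_derive (K := C_AbsRing) (V := C_NormedModule) sigma z) ->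
    (* sigma is odd *)
    (forall z : C, sigma (Copp z) = Copp (sigma z)) ->
    (* sigma(u) = u + O(u^5) as u -> 0 *)
    (exists (M r : R), 0 < r /\
       forall z : C, Cmod z < r -> Cmod (Cminus (sigma z) z) <= M * Cmod z ^ 5) ->
    (* zeta = sigma'/sigma *)
    (forall z : C, sigma z <> RtoC 0 ->
       is_derive (K := C_AbsRing) (V := C_NormedModule) sigma z (Cmult (zeta z) (sigma z))) ->
    (* wp = - zeta' *)
    (forall z : C, sigma z <> RtoC 0 ->
       is_derive (K := C_AbsRing) (V := C_NormedModule) zeta z (Copp (wp z))) ->
    (* dwp = wp' and wp'^2 = 4 wp^3 - g2 wp - g3 *)
    (forall z : C, sigma z <> RtoC 0 ->
       is_derive (K := C_AbsRing) (V := C_NormedModule) wp z (dwp z) /\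
       Cpow (dwp z) 2 =
         Cminus (Cminus (Cmult (RtoC 4) (Cpow (wp z) 3)) (Cmult g2 (wp z))) g3) ->
    forall v : C,
      (* v is not a pole of wp *)
      sigma v <> RtoC 0 ->
      exists r : R, 0 < r /\
        forall u : C, 0 < Cmod u < r ->
          is_series (K := C_AbsRing) (V := C_NormedModule)
            (fun k : nat =>
               Cmult (zpoly3_eval (P k) (wp v) (dwp v) (Cdiv g2 (RtoC 2)))
                     (Cdiv (Cpow u k) (RtoC (INR (fact k)))))
            (Cinv (BA sigma zeta u v)).
Proof.
  exists (fun n => zpoly4_diag (snd (BA_polys n))).
  intros g2 g3 sigma zeta wp dwp Hent _ H0 Hz Hw Hdw v Hv.
  assert (W : weierstrass g2 g3 sigma zeta wp dwp).
  { split.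
    - intros z. destruct (Hent z) as [l Hl]. exists l. apply cderiv_normed, Hl.
    - exact H0.
    - intros z Nz. apply cderiv_normed, Hz, Nz.
    - intros z Nz. apply cderiv_normed, Hw, Nz.
    - intros z Nz. apply cderiv_normed, Hdw, Nz.
    - intros z Nz. apply Hdw, Nz. }
  destruct (BA_inv_ode _ _ _ _ _ _ v W Hv) as (r & f & f1 & Hr & F0 & F1 & FB & HD).
  set (D := fun n t => (zpoly4_eval (fst (BA_polys n)) (wp (v - t)) (dwp (v - t)) (g2 / 2) (wp v) * f t
    + zpoly4_eval (snd (BA_polys n)) (wp (v - t)) (dwp (v - t)) (g2 / 2) (wp v) * f1 t)%C).
  assert (DD : forall n w, Cmod w < r -> cderiv (D n) w (D (S n) w)).
  { intros n w Hw'. destruct (HD w Hw') as (Nz & H1 & H2).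
    apply (BA_polys_cderiv f f1 (fun t => wp (v - t)%C) (fun t => dwp (v - t)%C)); [exact H1|exact H2| |].
    - apply cderiv_reflect, (wp_cderiv _ _ _ _ _ _ W), Nz.
    - apply cderiv_reflect, (wp_second_derivative _ _ _ _ _ _ W), Nz. }
  assert (Hh : holo r (D 0%nat)) by (intros w Hw'; eexists; apply DD, Hw').
  pose proof (holo_psum _ _ Hr Hh) as PS.
  pose proof (psum_chain D _ r Hr PS DD) as PC.
  exists r. split; [exact Hr|]. intros u Hu.
  assert (Hu0 : u <> 0) by (apply Cmod_pos_neq_0; lra).
  rewrite <- (FB u Hu0) by lra.
  assert (E : D 0%nat u = f u) by (unfold D; simpl; ring).
  rewrite <- E. eapply cseries_ext; [|apply PS; lra].
  intros n. cbv beta. rewrite PC. unfold D. rewrite F0, F1, zpoly4_eval_diag.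
  replace (v - 0)%C with v by ring. field.
  intros A. apply RtoC_inj in A. revert A. apply INR_fact_neq_0.
Qed.
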